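(* Let $p>1$ be a real number and let $\mathcal{D}\subseteq\mathbb{T}$ be the Dobiński set, regarded as a subset of the unit circle $\mathbb{T}$. Let $R_{\frac1p,p}$ denote the Riesz $(\frac1p,p)$-capacity on $\mathbb{T}$. Then \[ R_{\frac{1}{p},p}(\mathcal{D}) = R_{\frac{1}{p},p}(\mathbb{T}) \quad \text{if } 1<p\leq 2, \qquad\text{and}\qquad R_{\frac{1}{p},p}(\mathcal{D}) = 0 \quad \text{if } p>2. \]
   Context: Dobiński set. For $x\in[0,1]$ with dyadic expansion $x=(0.a_1a_2\dots)_2$ and $n\ge 1$, let $s_n(x)=\max\{r\in\mathbb{N}: a_n=a_{n+1}=\dots=a_{n+r}\}$, with the convention $s_n(x)=\infty$ if $x$ is a dyadic rational. The Dobiński set is \[ \mathcal{D}:=\Big\{x\in[0,1]: \limsup_{n\to\infty}\frac{s_n(x)}{2^n}>0\Big\}, \] and it is regarded as a subset of the unit circle $\mathbb{T}=\{z\in\mathbb{C}:|z|=1\}$ via $x\mapsto e^{2\pi i x}$. Riesz capacity. Let $dy$ be the normalized Lebesgue measure on $\mathbb{T}$. For $0<a<1$ and a nonnegative measurable function $f$ on $\mathbb{T}$, the $a$-Riesz potential of $f$ is \[ \mathcal{I}_a f(x):=\int_{\mathbb{T}}\frac{f(y)\,dy}{|x-y|^{1-a}},\quad x\in\mathbb{T}. \] For $1<p<\infty$ and a Borel set $E\subseteq\mathbb{T}$, the $(a,p)$-Riesz capacity of $E$ is \[ R_{a,p}(E):=\inf\Big\{\int_{\mathbb{T}}f(y)^p\,dy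 : f\ge 0 \text{ measurable and } \mathcal{I}_af\ge 1 \text{ on } E\Big\}. \] *)

(* Defs.v *)
From HB Require Import structures.
From mathcomp Require Import all_boot all_order all_algebra.
From mathcomp Require Import all_classical all_reals all_analysis.
From mathcomp Require Import measurable_realfun.
Set Implicit Arguments.
Unset Strict Implicit.
Unset Printing Implicit Defensive.
Import Order.TTheory GRing.Theory Num.Theory.
Import numFieldNormedType.Exports.
Local Open Scope classical_set_scope.
Local Open Scope ring_scope.

(* The complex plane is R * R with its product Borel sigma-algebra.  The
   library's norm on R * R is the sup norm, so the modulus is spelled out. *)
Definition eucl_dist (R : realType) (z w : R * R) : R :=
  Num.sqrt ((z.1 - w.1) ^+ 2 + (z.2 - w.2) ^+ 2).

Definition circle (R : realType) : set (R * R) :=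
  [set z | eucl_dist z (0, 0) = 1].
Arguments circle : clear implicits.

(* t |-> e^(2 i pi t) *)
Definition expi (R : realType) (t : R) : R * R :=
  (cos (2 * pi * t), sin (2 * pi * t)).

Lemma measurable_expi (R : realType) : measurable_fun setT (@expi R).
Proof.
have mlin : measurable_fun setT (fun t : R => 2 * pi * t).
  exact: mulrl_measurable.
apply: measurable_fun_pair.
- apply: measurableT_comp mlin.
  exact: continuous_measurable_fun (@continuous_cos R).
- apply: measurableT_comp mlin.
  exact: continuous_measurable_fun (@continuous_sin R).
Qed.

Definition circle_measure (R : realType) : set (R * R) -> \bar R :=
  pushforward
    (mrestr (@lebesgue_measure R) (measurable_itv `[0%R, 1%R])) (@expi R).
Arguments circle_measure : clear implicits.

Section circle_measure_instance.
Local Open Scope ereal_scope.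
Variable R : realType.
Let mexpi := @measurable_expi R.

Let circle_measure0 : circle_measure R set0 = 0.
Proof. exact: measure0. Qed.

Let circle_measure_ge0 A : 0 <= circle_measure R A.
Proof. exact: measure_ge0. Qed.

Let circle_measure_sigma_additive : semi_sigma_additive (circle_measure R).
Proof. exact: measure_semi_sigma_additive. Qed.

HB.instance Definition _ := isMeasure.Build _ _ _ (circle_measure R)
  circle_measure0 circle_measure_ge0 circle_measure_sigma_additive.

End circle_measure_instance.

Lemma circle_measure_circle (R : realType) :
  circle_measure R (circle R) = 1%E.
Proof.
rewrite /circle_measure /pushforward /mrestr.
have -> : @expi R @^-1` circle R = setT.
  apply/seteqP; split=> // t _; rewrite /circle /eucl_dist /expi /=.
  by rewrite !subr0 cos2Dsin2 sqrtr1.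
by rewrite setTI lebesgue_measure_itv/= lte_fin ltr01 oppr0 adde0.
Qed.

Section riesz.
Local Open Scope ereal_scope.
Variable R : realType.
Implicit Types (a p : R) (f : R * R -> \bar R) (E : set (R * R)).

(* The inverse is the one of \bar R, hence the kernel is +oo at y = x. *)
Definition riesz_potential a f (x : R * R) : \bar R :=
  \int[circle_measure R]_(y in circle R)
    (f y / (eucl_dist x y `^ (1 - a))%:E).

Definition riesz_admissible a E f : Prop :=
  [/\ measurable_fun (circle R) f,
      forall y, circle R y -> 0 <= f y &
      forall x, E x -> 1 <= riesz_potential a f x].

Definition riesz_capacity a p E : \bar R :=
  ereal_inf [set \int[circle_measure R]_(y in circle R) (f y `^ p)
            | f in riesz_admissible a E].

End riesz.

(* x = (0.a_1 a_2 ...)_2; the value a 0 plays no role. *)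
Definition dyadic_expansion (R : realType) (a : nat -> bool) (x : R) : Prop :=
  (fun N => \sum_(1 <= k < N.+1) (a k)%:R / 2 ^+ k) @ \oo --> x.

Definition dyadic_rational (R : realType) (x : R) : Prop :=
  exists (m : int) (k : nat), x = m%:~R / 2 ^+ k.

(* Outside the dyadic rationals the expansion a of x is unique and not
   eventually constant, so that the supremum is a maximum of naturals. *)
Definition dyadic_run (R : realType) (a : nat -> bool) (x : R) (n : nat)
    : \bar R :=
  if `[< dyadic_rational x >] then +oo%E
  else ereal_sup [set r%:R%:E | r in
         [set r : nat | forall j, (j <= r)%N -> a (n + j)%N = a n]].

Definition dobinski (R : realType) : set R :=
  [set x | 0 <= x <= 1 /\ exists a, dyadic_expansion a x /\
     (0 < limn_esup (fun n => dyadic_run a x n * ((2 ^+ n)^-1)%:E))%E].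

Arguments dobinski : clear implicits.

Definition dobinski_circle (R : realType) : set (R * R) :=
  @expi R @` dobinski R.
Arguments dobinski_circle : clear implicits.

(* Main.v *)
(* A point of the Dobinski set lies, for some c > 0 and infinitely many n, within
   2^(-c 2^n) of a dyadic rational m/2^n.

   For p > 2, f^p = sum_n q^n sum_(m <= 2^n) k_n(|z - e(m/2^n)|), where k_n is the
   kernel 1/x truncated at x = 2^(-2^n), has finite integral as soon as q < 1/4.
   Near such a point f is at least (q^n k_n)^(1/p), whose potential is of order
   q^(n/p) 2^n, which is unbounded if q > 2^(-p). Hence every positive
   multiple of f is admissible for the Dobinski set.

   For p <= 2, any f of finite energy admissible for the Dobinski set is
   admissible for the circle. If u, the potential of f, is < t < 1 at some point,
   its average over a short interval there is < t. Such an interval contains a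
   Lebesgue point of f^p where u < t, and by a Young inequality (this is where
   p <= 2 is used) the average of u over the interval of length 2^(-n-2^n)
   starting at the dyadic m/2^n just below that point is again < t, for all large
   n. Iterating yields nested intervals that meet in a point x of the Dobinski
   set. As u <= t at points arbitrarily close to x, comparing the kernels away
   from x gives u(x) <= t < 1: contradiction. *)
Require Import Defs.
From mathcomp Require Import all_boot all_order all_algebra.
From mathcomp Require Import all_classical all_reals all_analysis.
From mathcomp Require Import measurable_realfun ring lra.
Set Implicit Arguments.
Unset Strict Implicit.
Unset Printing Implicit Defensive.
Import Order.TTheory GRing.Theory Num.Theory.
Import numFieldNormedType.Exports.
Local Open Scope classical_set_scope.
Local Open Scope ring_scope.

(** * Chords of the circle *)

Section chord.
Variable R : realType.
Implicit Types s t x : R.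

(** The exponent [b = 1 - 1/p] is critical: with [p'] conjugate to [p], the [p']-th power of the
    kernel [d^(-b)] is [1/d], whose integral beyond distance [r] grows only like [log (1/r)]. For
    [r = 2^(-2^n)] this is of order [2^n], which is also the number of dyadic points of level [n].
    Reaching potential 1 near all of them costs about [2^n * (2^n)^(1-p) = 2^(n(2-p))], hence the
    threshold [p = 2]. For [p <= 2] the obstacle is that nothing controls the potential at a dyadic
    point itself: these points form a null set, on which a function of finite energy may have
    infinite potential. The nested construction therefore carries averages over intervals. Averaging
    over length [r] truncates the kernel at [r]; the resulting factor [log (1/r)], about [2^n], is
    balanced by the radius, of order [2^(-n)], of the neighbourhood of the Lebesgue point in which
    [f^p] has to be controlled. *)

Lemma sin_cosM x : 0 <= x -> exists2 c, 0 <= c <= x & sin x = cos c * x.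
Proof.
move=> x0.
have [|c] := @MVT_segment R (@sin R) (@cos R) 0 x x0.
  by apply/continuous_subspaceT => y; exact: continuous_sin.
by rewrite in_itv/= sin0 !subr0 => cx ->; exists c.
Qed.

Lemma ler_norm_sin x : `|sin x| <= `|x|.
Proof.
wlog x0 : x / 0 <= x => [H|].
  have [|/ltW] := leP 0 x; first exact: H.
  by rewrite -oppr_ge0 => /H; rewrite sinN !normrN.
have [c _ ->] := sin_cosM x0; rewrite normrM.
by rewrite ler_piMl// cos_max.
Qed.

(** A crude Jordan inequality. After halving the angle, both the cosine of the doubling formula and
    the one of the mean value theorem are taken at angles at most [pi / 4], where they are at least
    1/2. *)
Lemma sin_ge_quarter x : 0 <= x <= pi / 2 -> x / 4 <= sin x.
Proof.
move=> /andP[x0 xpi].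
have pi2 := @pihalf_lt2 R.
have cos_half y : 0 <= y <= pi / 4 -> 1 / 2 <= cos y.
  move=> /andP[y0 ypi].
  have c0 : 0 <= cos y.
    by apply: cos_ge0_pihalf; have := @pi_gt0 R; lra.
  have c2 : 0 <= cos (y + y) by apply: cos_ge0_pihalf; have := @pi_gt0 R; lra.
  rewrite cosD -!expr2 sin2cos2 in c2.
  rewrite leNgt; apply/negP => h.
  have : cos y ^+ 2 < 1 / 2 by rewrite expr2; nra.
  lra.
have -> : x = x / 2 *+ 2 by rewrite mulr2n; lra.
rewrite sin_mulr2n.
have x20 : 0 <= x / 2 by lra.
have [c cx ->] := sin_cosM x20.
have h1 : 1 / 2 <= cos c by apply: cos_half; lra.
have h2 : 1 / 2 <= cos (x / 2) by apply: cos_half; lra.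
have h3 : (x / 2) / 2 <= cos c * (x / 2) by nra.
by rewrite mulr2n; nra.
Qed.

Definition chord s t : R := eucl_dist (expi s) (expi t).

Lemma chordE s t : chord s t = 2 * `|sin (pi * (s - t))|.
Proof.
rewrite /chord /eucl_dist /expi/=.
have -> : (cos (2 * pi * s) - cos (2 * pi * t)) ^+ 2 +
          (sin (2 * pi * s) - sin (2 * pi * t)) ^+ 2 =
          (2 * `|sin (pi * (s - t))|) ^+ 2.
  rewrite exprMn real_normK ?num_real//.
  have h : cos (2 * pi * s - 2 * pi * t) = 1 - 2 * sin (pi * (s - t)) ^+ 2.
    have -> : 2 * pi * s - 2 * pi * t = pi * (s - t) + pi * (s - t) by ring.
    by rewrite cosD -!expr2 cos2sin2; ring.
  have h1 := cos2Dsin2 (2 * pi * s); have h2 := cos2Dsin2 (2 * pi * t).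
  rewrite cosB in h.
  rewrite !sqrrB.
  have -> : 2 ^+ 2 * sin (pi * (s - t)) ^+ 2 = 2 * (2 * sin (pi * (s - t)) ^+ 2) by ring.
  have -> : 2 * sin (pi * (s - t)) ^+ 2 = 1 - (cos (2 * pi * s) * cos (2 * pi * t) +
    sin (2 * pi * s) * sin (2 * pi * t)) by rewrite h; ring.
  rewrite !mulr2n; lra.
by rewrite sqrtr_sqr ger0_norm// mulr_ge0.
Qed.

Lemma chord_ge0 s t : 0 <= chord s t. Proof. exact: sqrtr_ge0. Qed.

Lemma chordC s t : chord s t = chord t s.
Proof. by rewrite !chordE -(opprB s t) mulrN sinN normrN. Qed.

Lemma chord_triangle r s t : chord s t <= chord s r + chord r t.
Proof.
rewrite !chordE -mulrDr ler_pM2l//.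
have -> : pi * (s - t) = pi * (s - r) + pi * (r - t) by ring.
rewrite sinD (le_trans (ler_normD _ _))// !normrM lerD//.
  by rewrite ler_piMr// cos_max.
by rewrite ler_piMl// cos_max.
Qed.

(** The constant 8 is a bound for [2 * pi], from [pi / 2 < 2]; it is the source of the quotients
    [8 / L] further on. *)
Lemma chord_le s t : chord s t <= 8 * `|s - t|.
Proof.
rewrite chordE; have := ler_norm_sin (pi * (s - t)).
rewrite normrM (ger0_norm (pi_ge0 R)).
have := @pihalf_lt2 R; have := normr_ge0 (s - t).
move: `|s - t| `|sin _| => a b; have := @pi_ge0 R; nra.
Qed.

(** The minimum is the distance modulo 1, since the parameters 0 and 1 give the same point. For
    [s - t > 1/2] the bound comes from the reflection [sin (pi - y) = sin y]. *)
Lemma chord_ge s t : 0 <= s <= 1 -> 0 <= t <= 1 ->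
  Num.min `|s - t| (1 - `|s - t|) <= chord s t.
Proof.
wlog ts : s t / t <= s => [H s01 t01|].
  have [ts|/ltW ts] := leP t s; first exact: H.
  by rewrite distrC chordC; exact: H.
move=> s01 t01; rewrite chordE ger0_norm ?subr_ge0//.
have pi2 := @pihalf_ge1 R.
have [h|h] := leP (s - t) (1 / 2).
  have : pi * (s - t) / 4 <= sin (pi * (s - t)).
    by apply: sin_ge_quarter; nra.
  move=> h1; have h2 := ler_norm (sin (pi * (s - t))).
  by rewrite ge_min; apply/orP; left; nra.
have : pi * (1 - (s - t)) / 4 <= sin (pi * (1 - (s - t))).
  by apply: sin_ge_quarter; nra.
have -> : sin (pi * (1 - (s - t))) = sin (pi * (s - t)).
  have -> : pi * (1 - (s - t)) = - (pi * (s - t) - pi) by ring.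
  rewrite sinN -[in RHS](subrK pi (pi * (s - t))).
  by rewrite sinDpi.
move=> h1; have h2 := ler_norm (sin (pi * (s - t))).
by rewrite ge_min; apply/orP; right; nra.
Qed.

End chord.

(** * Truncated logarithmic kernel and integration on the circle *)

Section dyadic_kernel.
Variable R : realType.
Implicit Types (J : nat) (x : R).

(* Comparable to 1 / max x (2^-J), so its integral over an interval around 0 is
   of order J. *)
Definition dyadic_kernel J x : R :=
  \sum_(j < J) (if x <= (2 ^+ j)^-1 then 2 ^+ j else 0).

Lemma dyadic_kernelS J x : dyadic_kernel J.+1 x =
  dyadic_kernel J x + (if x <= (2 ^+ J)^-1 then 2 ^+ J else 0).
Proof. by rewrite /dyadic_kernel big_ord_recr. Qed.

Lemma dyadic_kernel_ge0 J x : 0 <= dyadic_kernel J x.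
Proof. by apply: sumr_ge0 => j _; case: ifP => // _; rewrite exprn_ge0. Qed.

Lemma dyadic_kernel_nd J J' x : (J <= J')%N ->
  dyadic_kernel J x <= dyadic_kernel J' x.
Proof.
move=> /subnK <-; elim: (J' - J)%N => // n /le_trans; apply.
rewrite addSn dyadic_kernelS lerDl; case: ifP => // _; exact: exprn_ge0.
Qed.

Lemma dyadic_kernel_lt J x : dyadic_kernel J x < 2 ^+ J.
Proof.
elim: J => [|J IH]; first by rewrite /dyadic_kernel big_ord0.
rewrite dyadic_kernelS exprS; case: ifP => _; last first.
  by have := exprn_ge0 J (@ler0n R 2); lra.
by lra.
Qed.

Lemma dyadic_kernel_max_le2 J x : 0 <= x ->
  dyadic_kernel J x * Num.max x (2 ^+ J)^-1 <= 2.
Proof.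
move=> x0; have P (n : nat) : 0 < 2 ^+ n :> R by rewrite exprn_gt0.
have h1 : dyadic_kernel J x * (2 ^+ J)^-1 <= 2.
  rewrite ler_pdivrMr//; have := dyadic_kernel_lt J x; have := P J; lra.
suff h2 : dyadic_kernel J x * x <= 2 by rewrite maxEle; case: ifP.
elim: J {h1} => [|J IH]; first by rewrite /dyadic_kernel big_ord0 mul0r.
rewrite dyadic_kernelS; case: ifPn => h; last by rewrite addr0.
have := dyadic_kernel_lt J.+1 x; rewrite dyadic_kernelS h.
set u := _ + _ => hu; rewrite (@le_trans _ _ (2 ^+ J.+1 * (2 ^+ J)^-1))//.
  rewrite ler_pM//; last exact: ltW.
  by rewrite addr_ge0 ?dyadic_kernel_ge0// ltW.
by rewrite exprS mulfK// gt_eqF.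
Qed.

(** The index is [J.+1] because the empty sum [dyadic_kernel 0] vanishes. *)
Lemma dyadic_kernel_max_ge J x : x <= 1 ->
  1 <= 2 * (dyadic_kernel J.+1 x * Num.max x (2 ^+ J.+1)^-1).
Proof.
move=> x1; have P (n : nat) : 0 < 2 ^+ n :> R by rewrite exprn_gt0.
elim: J => [|J IH].
  rewrite /dyadic_kernel big_ord_recl big_ord0 expr0 invr1 x1 addr0 mul1r expr1.
  by rewrite maxEle; case: ifPn => h; lra.
rewrite dyadic_kernelS; case: ifPn => h.
  rewrite (@le_trans _ _ (2 * (2 ^+ J.+1 * (2 ^+ J.+2)^-1)))//.
    rewrite (exprS _ J.+1); have := P J.+1; move: (2 ^+ J.+1) => y y0.
    by have -> : 2 * (y / (2 * y)) = 1 by field; rewrite gt_eqF.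
  rewrite ler_pM2l// ler_pM//.
  - by rewrite lerDr dyadic_kernel_ge0.
  - by rewrite le_max lexx orbT.
rewrite addr0 (le_trans IH)// ler_pM2l// ler_wpM2l ?dyadic_kernel_ge0//.
by rewrite ge_max !le_max lexx/= ltW// ltNge.
Qed.

Lemma measurable_dyadic_kernel J : measurable_fun setT (dyadic_kernel J).
Proof.
apply: measurable_sum => j; apply: measurable_fun_ifT => //.
exact: measurable_fun_ler.
Qed.

End dyadic_kernel.

(** * Integration on the circle through the parameter in [0, 1], and the singular kernel *)

Section circle_integral.
Variable R : realType.
Local Notation mu := (@lebesgue_measure R).
Local Open Scope ereal_scope.

Lemma measurable_eucl_dist (w : R * R) :
  measurable_fun setT (fun z : R * R => eucl_dist z w).
Proof.
apply: measurableT_comp => //.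
  by apply: continuous_measurable_fun; exact: sqrt_continuous.
by apply: measurable_funD; apply: measurable_funX; apply: measurable_funB.
Qed.

Lemma measurable_circle : measurable (circle R).
Proof.
rewrite (_ : circle R = (fun z => eucl_dist z (0, 0)%R) @^-1` [set 1%R]); last by [].
by rewrite -[X in measurable X]setTI; apply: measurable_eucl_dist.
Qed.

Lemma expi_circle (t : R) : circle R (expi t).
Proof.
by rewrite /circle /eucl_dist /expi /= !subr0 cos2Dsin2 sqrtr1.
Qed.

Lemma measurable_comp_expi (f : R * R -> \bar R) :
  measurable_fun (circle R) f -> measurable_fun setT (f \o @expi R).
Proof.
move=> mf; apply: (measurable_comp measurable_circle) => //.
  by move=> _ [t _ <-]; exact: expi_circle.
exact: measurable_expi.
Qed.

Lemma ge0_integral_circle (f : R * R -> \bar R) :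
  measurable_fun (circle R) f -> (forall z, circle R z -> 0 <= f z) ->
  \int[circle_measure R]_(z in circle R) f z =
  \int[mu]_(t in `[0%R, 1%R]) f (expi t).
Proof.
move=> mf f0.
have mfe : measurable_fun setT (f \o @expi R) by exact: measurable_comp_expi.
rewrite /circle_measure ge0_integral_pushforward//; first last.
- by move=> z; rewrite inE; exact: f0.
- exact: measurable_circle.
- exact: measurable_expi.
rewrite (_ : _ @^-1` _ = setT); last first.
  by apply/seteqP; split => // t _; exact: expi_circle.
have mI : measurable (`[0%R, 1%R]%classic : set R) by exact: measurable_itv.
pose nu : {measure set (measurableTypeR R) -> \bar R} := mrestr mu mI.
(* The restricted measure [nu] does not charge the complement of [0, 1], so that part of the domain
   is removed before [nu] is compared with [mu]. *)
have H := @ge0_negligible_integral _ _ _ nu setT (~` (`[0%R, 1%R]%classic : set R)) (f \o @expi R).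
rewrite [LHS]H//.
- rewrite setTD setCK /=; apply: (eq_measure_integral mu) => A _ AI.
  by rewrite /= /mrestr setIidl.
- exact: measurableC.
- by move=> x _; apply: f0; exact: expi_circle.
- by rewrite /= /mrestr setICl measure0.
Qed.

Lemma measurable_chord2 : measurable_fun setT (fun z : R * R => chord z.1 z.2).
Proof.
have m1 : measurable_fun setT (fun z : R * R => expi z.1).
  by apply: measurableT_comp; [exact: measurable_expi|exact: measurable_fst].
have m2 : measurable_fun setT (fun z : R * R => expi z.2).
  by apply: measurableT_comp; [exact: measurable_expi|exact: measurable_snd].
apply: (measurableT_comp (f := @Num.sqrt R)).
  by apply: continuous_measurable_fun; exact: sqrt_continuous.
apply: measurable_funD; apply: measurable_funX; apply: measurable_funB.
- exact: (measurableT_comp measurable_fst m1).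
- exact: (measurableT_comp measurable_fst m2).
- exact: (measurableT_comp measurable_snd m1).
- exact: (measurableT_comp measurable_snd m2).
Qed.

(* The kernel of [riesz_potential] is [rkernel (1 - a)]; at [d = 0] it is +oo. *)
Definition rkernel (b : R) (d : R) : \bar R := ((d `^ b)%R%:E)^-1.

Lemma rkernelE b d : (0 < d)%R -> rkernel b d = (d `^ (- b))%:E.
Proof. by move=> d0; rewrite /rkernel powRN inver gt_eqF// powR_gt0. Qed.

Lemma rkernel_ge0 b d : 0 <= rkernel b d.
Proof. by rewrite /rkernel inve_ge0 lee_fin powR_ge0. Qed.

Lemma measurable_inve : measurable_fun setT (fun x : R => (x%:E)^-1).
Proof.
have -> : (fun x : R => (x%:E)^-1) = (fun x => if (0 < x)%R then (x `^ (-1))%:E else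
   if (x < 0)%R then (- ((- x) `^ (-1)))%:E else +oo).
  apply/funext => x; rewrite inver; case: ltgtP => [x0|x0|x0].
  - by rewrite powR_inv1 // ltW.
  - by rewrite powR_inv1 ?oppr_ge0 ?(ltW x0)// invrN opprK.
  - by [].
apply: measurable_fun_ifT; first exact: measurable_fun_ltr.
  by apply/measurable_EFinP; exact: measurable_powR.
apply: measurable_fun_ifT => //; first exact: measurable_fun_ltr.
apply/measurable_EFinP; apply: measurableT_comp => //.
apply: (measurableT_comp (measurable_powR _)).
exact: oppr_measurable.
Qed.

Lemma measurable_rkernel b : measurable_fun setT (rkernel b).
Proof.
exact: (measurableT_comp measurable_inve (measurable_powR _)).
Qed.

Lemma rkernel_le b d d' : (0 <= b)%R -> (0 <= d' <= d)%R -> rkernel b d <= rkernel b d'.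
Proof.
move=> b0 /andP[d'0 d'd]; rewrite /rkernel.
have h : (d' `^ b <= d `^ b)%R by rewrite ge0_ler_powR// nnegrE// (le_trans d'0).
rewrite !inver; case: (eqVneq (d' `^ b)%R 0%R) => [_|n0]; first exact: leey.
have p0 : (0 < d' `^ b)%R by rewrite lt_def n0 powR_ge0.
have p1 := lt_le_trans p0 h.
by rewrite gt_eqF// lee_fin lef_pV2.
Qed.

End circle_integral.

(** * Measures of neighbourhoods and integrals of the kernels *)

Section integrals.
Variable R : realType.
Local Notation mu := (@lebesgue_measure R).
Local Notation I01 := (`[0%R, 1%R]%classic : set R).
Local Open Scope ereal_scope.

Lemma lebesgue_measure_itvcc (a b : R) : (a <= b)%R ->
  mu `[a, b]%classic = (b - a)%:E.
Proof.
rewrite le_eqVlt lebesgue_measure_itv/= lte_fin => /predU1P[->|->//].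
by rewrite ltxx subrr.
Qed.

Lemma measurable_le_cst (phi : R -> R) (c : R) : measurable_fun setT phi ->
  measurable [set t | (phi t <= c)%R].
Proof.
move=> mphi; rewrite (_ : [set t | _] = setT `&` phi @^-1` `]-oo, c]%classic).
  exact: (mphi measurableT _ (measurable_itv _)).
by apply/seteqP; split => t /=; rewrite in_itv/= => // -[].
Qed.

Lemma ge0_integral_if (D : set R) (phi : R -> R) (c k : R) : measurable D ->
  measurable_fun setT phi -> (0 <= k)%R ->
  \int[mu]_(t in D) (if (phi t <= c)%R then k else 0%R)%:E =
  k%:E * mu (D `&` [set t | (phi t <= c)%R]).
Proof.
move=> mD mphi k0; have mA := measurable_le_cst c mphi.
transitivity (\int[mu]_(t in D) (k%:E * (\1_[set t | (phi t <= c)%R] t)%:E)); last first.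
  rewrite ge0_integralZl//.
  - by rewrite integral_indic// setIC.
  - by apply/measurable_EFinP; apply: measurable_funTS; exact: measurable_indic.
apply: eq_integral => t _; rewrite indicE; case: ifPn => h.
  by rewrite mem_set//= mule1.
by rewrite memNset ?mule0//=; exact/negP.
Qed.

Lemma integral_dyadic_kernel (D : set R) (phi : R -> R) J : measurable D ->
  measurable_fun setT phi ->
  \int[mu]_(t in D) (dyadic_kernel J (phi t))%:E =
  \sum_(j < J) (2 ^+ j)%:E * mu (D `&` [set t | (phi t <= (2 ^+ j)^-1)%R]).
Proof.
move=> mD mphi; rewrite /dyadic_kernel.
under eq_integral do rewrite -sumEFin.
rewrite ge0_integral_sum//.
- apply: eq_bigr => j _; rewrite ge0_integral_if//; exact: exprn_ge0.
- move=> j; apply/measurable_EFinP.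
  apply: (@measurable_funS _ _ _ _ setT) => //.
  by apply: measurable_fun_ifT => //; exact: measurable_fun_ler.
- by move=> j t _; rewrite lee_fin; case: ifP => // _; exact: exprn_ge0.
Qed.

Lemma measurable_dist (y : R) : measurable_fun setT (fun t : R => `|t - y|%R).
Proof. by apply: measurableT_comp => //; exact: measurable_funB. Qed.

Lemma measurable_chord (s : R) : measurable_fun setT (fun t : R => chord t s).
Proof.
exact: (measurableT_comp (measurable_eucl_dist (expi s)) (@measurable_expi R)).
Qed.

Lemma dist_le_itv (y r : R) : [set t | (`|t - y| <= r)%R] = `[(y - r)%R, (y + r)%R]%classic.
Proof. by apply/seteqP; split => t /=; rewrite in_itv/= ler_distl. Qed.

Lemma measure_dist_le (D : set R) (y r : R) : measurable D -> (0 <= r)%R ->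
  mu (D `&` [set t | (`|t - y| <= r)%R]) <= (2 * r)%:E.
Proof.
move=> mD r0; rewrite (@le_trans _ _ (mu `[(y - r)%R, (y + r)%R]%classic))//.
  rewrite dist_le_itv; apply: le_measure; rewrite ?inE//.
  by apply: measurableI.
by rewrite lebesgue_measure_itvcc ?lee_fin; lra.
Qed.

(** The set is covered by the interval of radius [r] around [s] and, because of the wrap-around at 0
    and 1, by two end segments of length [r]: [2 r + r + r]. *)
Lemma measure_chord_le (s r : R) : (0 <= s <= 1)%R -> (0 <= r)%R ->
  mu (I01 `&` [set t | (chord t s <= r)%R]) <= (4 * r)%:E.
Proof.
move=> s01 r0.
have sub : I01 `&` [set t | (chord t s <= r)%R] `<=`
    `[(s - r)%R, (s + r)%R] `|` (`[0%R, r] `|` `[(1 - r)%R, 1%R]).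
  move=> t [/=]; rewrite !in_itv/= => t01 tr.
  have := le_trans (chord_ge t01 s01) tr; rewrite ge_min => /orP[].
    by rewrite ler_distl => h; left.
  case: (leP s t) => st; [rewrite ger0_norm ?subr_ge0//|rewrite ltr0_norm ?subr_lt0//].
    by move=> h; right; right; apply/andP; split; lra.
  by move=> h; right; left; apply/andP; split; lra.
apply: (@le_trans _ _ (mu (`[(s - r)%R, (s + r)%R] `|` (`[0%R, r] `|` `[(1 - r)%R, 1%R])))).
  apply: le_measure => //; rewrite inE; last by do 2 apply: measurableU => //.
  by apply: measurableI => //; exact: (measurable_le_cst _ (measurable_chord s)).
have mU2 (A B : set R) : measurable A -> measurable B -> mu (A `|` B) <= mu A + mu B.
  by move=> mA mB; exact: (measureU2 mu).
rewrite (le_trans (mU2 _ _ _ _))//; first by apply: measurableU.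
rewrite (le_trans (leeD2l _ (mU2 _ _ _ _)))//.
by rewrite !lebesgue_measure_itvcc -?EFinD ?lee_fin; lra.
Qed.

Lemma measure_chord_ge (s r : R) : (0 <= s <= 1)%R -> (0 <= r <= 1)%R ->
  (r / 8)%:E <= mu (I01 `&` [set t | (chord t s <= r)%R]).
Proof.
move=> s01 r01.
have mA : measurable (I01 `&` [set t | (chord t s <= r)%R]).
  by apply: measurableI => //; exact: (measurable_le_cst _ (measurable_chord s)).
(* The interval goes to the right or to the left of [s] according to the half of [0, 1] that
   contains [s], so that it stays in [0, 1]; its length [r / 8] compensates [chord_le]. *)
pose a := if (s <= 1 / 2)%R then s else (s - r / 8)%R.
have -> : (r / 8)%:E = mu `[a, (a + r / 8)%R]%classic.
  rewrite lebesgue_measure_itvcc; last lra.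
  by congr (_%:E); lra.
apply: le_measure; rewrite ?inE// => t /=; rewrite in_itv/= /a => h.
have h2 := chord_le t s.
have h1 : (`|t - s| <= r / 8)%R by rewrite ler_distl; move: h; case: ifP => _; lra.
split; last by lra.
by rewrite in_itv/=; move: h; case: (leP s (1 / 2)%R) => ?; lra.
Qed.

Lemma nneseries_term_le (u : nat -> \bar R) k : (forall n, 0 <= u n) ->
  u k <= \sum_(n <oo) u n.
Proof.
move=> u0; apply: le_trans (nneseries_lim_ge k.+1 _); last by move=> *; exact: u0.
rewrite big_mkord big_ord_recr/= leeDr//; exact: sume_ge0.
Qed.

Lemma measurable_rkernel_dist b (y : R) :
  measurable_fun setT (fun s : R => rkernel b `|s - y|%R).
Proof. exact: (measurableT_comp (measurable_rkernel b) (measurable_dist y)). Qed.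

(* Since b <= 1/2, the j-th term has integral of order 2^-j. *)
Lemma rkernel_le_dyadic (b d r : R) : (0 <= b <= 1 / 2)%R -> (0 < d <= r)%R ->
  rkernel b d <= \sum_(j <oo)
    (if (d <= r * (4 ^+ j)^-1)%R then r `^ (- b) * 2 ^+ j.+1 else 0)%:E.
Proof.
move=> b0 /andP[d0 dr]; have r0 := lt_le_trans d0 dr.
have P (n : nat) : (0 < 4 ^+ n :> R)%R by rewrite exprn_gt0.
(* [j] is the base 4 scale of [d / r]; its term alone already dominates the kernel. *)
have [j dj dj1] : exists2 j, (d <= r * (4 ^+ j)^-1)%R & (r * (4 ^+ j.+1)^-1 < d)%R.
  have ex : exists n, (r * (4 ^+ n)^-1 < d)%R.
    have [n hn] := ltr_add_invr (divr_gt0 d0 r0); exists n.+1.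
    rewrite mulrC -ltr_pdivlMr//; apply: le_lt_trans hn; rewrite add0r lef_pV2 ?posrE//.
    by rewrite -natrX ler_nat ltnW// ltn_expl.
  case: (ex_minnP ex) => -[|j]; first by rewrite expr0 invr1 mulr1 ltNge dr.
  move=> h1 h2; exists j => //; rewrite leNgt; apply/negP => /h2.
  by rewrite ltnn.
pose u j := (if (d <= r * (4 ^+ j)^-1)%R then r `^ (- b) * 2 ^+ j.+1 else 0)%:E.
apply: (@le_trans _ _ (u j)); last first.
  apply: nneseries_term_le => n; rewrite /u lee_fin; case: ifP => // _.
  by rewrite mulr_ge0 ?powR_ge0 ?exprn_ge0.
rewrite /u dj rkernelE// lee_fin.
(* As a square root of [4 ^+ j.+1], this factor dominates its power [b], by [b <= 1/2]. *)
have -> : (2 ^+ j.+1 = (4 ^+ j.+1) `^ (2^-1) :> R)%R.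
  have e4 : (4 = 2 ^+ 2 :> R)%R by rewrite expr2; lra.
  by rewrite powR12_sqrt ?exprn_ge0// e4 exprAC sqrtr_sqr ger0_norm// exprn_ge0.
have b1 : (0 <= - - b)%R by rewrite opprK; lra.
apply: (@le_trans _ _ ((r * (4 ^+ j.+1)^-1) `^ (- b)))%R.
  rewrite !powRN lef_pV2 ?posrE ?powR_gt0 ?divr_gt0//.
  by rewrite ge0_ler_powR ?nnegrE ?divr_ge0 ?(ltW d0) ?(ltW r0) ?(ltW (P _)) ?(ltW dj1)//; lra.
rewrite powRM ?invr_ge0 ?(ltW r0) ?(ltW (P _))// ler_wpM2l ?powR_ge0//.
rewrite -[in leLHS](@powR_inv1 _ (4 ^+ j.+1)) ?(ltW (P _))// -powRrM mulN1r opprK.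
by rewrite ler_powR ?exprn_ege1//; lra.
Qed.

Lemma integral_rkernel_le (b r y : R) : (0 <= b <= 1 / 2)%R -> (0 < r)%R ->
  \int[mu]_(s in [set s | (`|s - y| <= r)%R]) rkernel b `|s - y|%R <=
  (8 * r `^ (1 - b))%:E.
Proof.
move=> b0 r0; set D := [set s | _].
have mD : measurable D by exact: measurable_le_cst (measurable_dist y).
have m1 := measurable_rkernel_dist b y.
have mD1 : measurable (D `\ y) by apply: measurableD.
(* The centre is removed because the dyadic bound requires a positive distance. *)
rewrite -(integral_setD1 mD1); last exact: measurable_funTS m1.
pose u j s := (if (`|s - y| <= r * (4 ^+ j)^-1)%R then r `^ (- b) * 2 ^+ j.+1 else 0)%:E.
have c0 j : (0 <= r `^ (- b) * 2 ^+ j.+1)%R by rewrite mulr_ge0 ?powR_ge0 ?exprn_ge0.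
have u0 j s : 0 <= u j s by rewrite /u lee_fin; case: ifP.
have mu_ j : measurable_fun (D `\ y) (u j).
  apply/measurable_EFinP; apply: measurable_funTS.
  apply: measurable_fun_ifT => //; apply: measurable_fun_ler => //.
  exact: measurable_dist.
apply: (@le_trans _ _ (\int[mu]_(s in D `\ y) \sum_(j <oo) u j s)).
  apply: ge0_le_integral => //.
  - by move=> s _; exact: rkernel_ge0.
  - exact: measurable_funTS.
  - by apply: (@ge0_emeasurable_sum _ _ _ _ u xpredT) => // j s _ _; exact: u0.
  - move=> s [Ds /eqP sy]; apply: rkernel_le_dyadic => //.
    by rewrite normr_gt0 subr_eq0 sy.
rewrite integral_nneseries//.
(* Height [r^(-b) 2^(j+1)] on a set of measure at most [2 r 4^(-j)]: the product is
   [4 r^(1-b) 2^(-j)]. *)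
have h j : \int[mu]_(s in D `\ y) u j s <= ((8 * r `^ (1 - b)) / (2 ^ (j + 1))%:R)%:E.
  rewrite /u ge0_integral_if//; last exact: measurable_dist.
  rewrite (le_trans (lee_wpmul2l _ (measure_dist_le _ mD1 _)))//.
    by rewrite lee_fin.
    by rewrite divr_ge0 ?exprn_ge0 ?ltW.
  rewrite -EFinM lee_fin addn1 natrX.
  have -> : (r `^ (1 - b) = r * r `^ (- b))%R.
    by rewrite powRD ?(gt_eqF r0) ?implybT// powRr1 ?ltW.
  have e4 : (4 = 2 * 2 :> R)%R by lra.
  rewrite e4 exprMn.
  rewrite !exprS; have : (2 ^+ j != 0 :> R)%R by rewrite expf_neq0.
  move: (2 ^+ j)%R (r `^ (- b))%R => e f e0.
  rewrite [leLHS](_ : _ = 8 * (r * f) / (2 * e))%R//; field; exact: e0.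
apply: (@le_trans _ _ (\sum_(j <oo) ((8 * r `^ (1 - b)) / (2 ^ (j + 1))%:R)%:E)).
  apply: lee_nneseries => // j _ _; apply: integral_ge0 => s _; exact: u0.
have := @cvg_geometric_eseries_half R (8 * r `^ (1 - b)) 0.
by move/cvg_lim => H; rewrite [X in X <= _]H// expr0 divr1.
Qed.

End integrals.

(** * Binary expansions and the Dobinski set *)

Section binary.
Variable R : realType.
Implicit Types (a : nat -> bool) (x : R).

Lemma pow2_gt0 n : 0 < 2 ^+ n :> R. Proof. by rewrite exprn_gt0. Qed.

Lemma pow2V_gt0 n : 0 < (2 ^+ n)^-1 :> R. Proof. by rewrite invr_gt0 pow2_gt0. Qed.

Lemma pow2VS n : (2 ^+ n.+1)^-1 = (2 ^+ n)^-1 / 2 :> R.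
Proof. by rewrite exprS invfM mulrC. Qed.

Definition binary_sum a m N : R := \sum_(m.+1 <= k < N.+1) (a k)%:R / 2 ^+ k.

Lemma binary_sumS a m N : (m <= N)%N ->
  binary_sum a m N.+1 = binary_sum a m N + (a N.+1)%:R / 2 ^+ N.+1.
Proof. by move=> mN; rewrite /binary_sum big_nat_recr. Qed.

Lemma binary_sum_cat a m n N : (m <= n <= N)%N ->
  binary_sum a m N = binary_sum a m n + binary_sum a n N.
Proof. by move=> /andP[mn nN]; rewrite /binary_sum (big_cat_nat (n := n.+1)). Qed.

Lemma binary_sum_bound a m N : (m <= N)%N ->
  0 <= binary_sum a m N <= (2 ^+ m)^-1 - (2 ^+ N)^-1.
Proof.
move=> /subnKC <-; elim: (N - m)%N => [|n IH].
  by rewrite addn0 /binary_sum big_geq// subrr lexx.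
rewrite addnS binary_sumS ?leq_addr// pow2VS.
have := pow2V_gt0 (m + n); move: (2 ^- _) IH => e.
by case: (a _); rewrite /= ?mul1r ?mul0r; lra.
Qed.

Lemma binary_sum_nat a N : exists2 M, (M < 2 ^ N)%N &
  binary_sum a 0 N = M%:R / 2 ^+ N.
Proof.
elim: N => [|N [M MN IH]].
  by exists 0%N => //; rewrite /binary_sum big_geq// mul0r.
exists (M.*2 + a N.+1)%N.
  by rewrite expnS mul2n; case: (a _); rewrite ?addn0 ?addn1 ?ltn_double ?ltn_Sdouble.
rewrite binary_sumS// IH natrD -muln2 natrM mulrDl; congr (_ + _).
by rewrite exprS invfM mulrA mulfK.
Qed.

Lemma dyadic_expansion_dist a x N : dyadic_expansion a x ->
  0 <= x - binary_sum a 0 N <= (2 ^+ N)^-1.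
Proof.
move=> ax.
have cS : cvgn (binary_sum a 0) by apply/cvg_ex; exists x.
have h k : (N <= k)%N -> binary_sum a 0 N <= binary_sum a 0 k <= binary_sum a 0 N + (2 ^+ N)^-1.
  move=> Nk; have := binary_sum_bound a Nk.
  rewrite (@binary_sum_cat a 0 N k)//; have := pow2V_gt0 k; lra.
have xE : x = limn (binary_sum a 0) by apply/esym/(cvg_lim _ ax).
have h1 : binary_sum a 0 N <= x.
  by rewrite xE; apply: limr_ge => //; exists N => // k /= /h /andP[].
have h2 : x <= binary_sum a 0 N + (2 ^+ N)^-1.
  by rewrite xE; apply: limr_le => //; exists N => // k /= /h /andP[].
by apply/andP; split; lra.
Qed.

Lemma binary_sum_run a n r :
  (forall j, (j <= r)%N -> a (n.+1 + j)%N = a n.+1) ->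
  binary_sum a n (n + r).+1 = (a n.+1)%:R * ((2 ^+ n)^-1 - (2 ^+ (n + r).+1)^-1).
Proof.
elim: r => [|r IH] ar.
  rewrite addn0 binary_sumS// /binary_sum big_geq// add0r pow2VS; congr (_ * _); lra.
rewrite addnS binary_sumS ?leqW ?leq_addr// IH => [|j jr]; last by apply: ar; exact: leqW.
have := ar r.+1 (leqnn _); rewrite addnS addSn => ->.
rewrite -mulrDr; congr (_ * _); rewrite (pow2VS (n + r).+1); lra.
Qed.

(** A run of zeros puts [x] just above its truncation [M / 2^n], a run of ones just below
    [(M + 1) / 2^n]; the second case is why [m] may equal [2 ^ n]. *)
Lemma run_approx a x n r : dyadic_expansion a x ->
  (forall j, (j <= r)%N -> a (n.+1 + j)%N = a n.+1) ->
  exists2 m, (m <= 2 ^ n)%N & `|x - m%:R / 2 ^+ n| <= (2 ^+ (n + r).+1)^-1.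
Proof.
move=> ax ar.
have [M MN SM] := binary_sum_nat a n.
have := dyadic_expansion_dist (n + r).+1 ax.
rewrite (@binary_sum_cat a 0 n) ?leqW ?leq_addr// SM binary_sum_run//.
have h := pow2V_gt0 (n + r).+1.
case: (a n.+1) => H; [exists M.+1 => //|exists M; first exact: ltnW].
  by rewrite -natr1 mulrDl mul1r ler_norml; move: H; rewrite mul1r; lra.
by rewrite ler_norml; move: H; rewrite mul0r; lra.
Qed.

Lemma limn_esup_gtP (u : nat -> \bar R) (c : R) : (c%:E < limn_esup u)%E ->
  forall N, exists2 n, (N <= n)%N & (c%:E < u n)%E.
Proof.
move=> cu N; apply: contrapT => H; move: cu; apply/negP; rewrite -leNgt.
apply: (@le_trans _ _ (ereal_sup (u @` [set n | (N <= n)%N]))).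
  by apply: ereal_inf_lbound; exists [set n | (N <= n)%N] => //; exists N.
apply: ge_ereal_sup => _ [n /= Nn <-]; rewrite leNgt; apply/negP => h.
by apply: H; exists n.
Qed.

Lemma limn_esup_geP (u : nat -> \bar R) (c : \bar R) :
  (forall N, exists2 n, (N <= n)%N & (c <= u n)%E) -> (c <= limn_esup u)%E.
Proof.
move=> H; apply: le_ereal_inf_tmp => _ [V [N _ NV] <-].
have [n Nn cn] := H N; apply: le_trans cn _.
by apply: ereal_sup_ubound; exists n => //; exact: NV.
Qed.

Lemma lt0e_dense (y : \bar R) : (0 < y)%E -> exists2 c : R, 0 < c & (c%:E < y)%E.
Proof.
case: y => [r| |//]; last by exists 1 => //; rewrite ltry.
by rewrite lte_fin => r0; exists (r / 2); rewrite ?lte_fin; lra.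
Qed.

(** [K] is an integer above [2 / c] for some positive [c] below the limsup. It depends on [x] only,
    and [2 ^ n <= K * j] says that [j] is at least a fixed fraction of [2 ^ n]. *)
Lemma dobinski_approx x : dobinski R x -> exists2 K, (0 < K)%N & forall N,
  exists n m j, [/\ (N <= n)%N, (m <= 2 ^ n)%N, (2 ^ n <= K * j)%N &
    `|x - m%:R / 2 ^+ n| <= (2 ^+ j)^-1].
Proof.
move=> [/andP[x0 x1] [a [ax]]]; rewrite /dyadic_run; case: asboolP => [|_].
  move=> [[m|m] [k xE]] _; last first.
    move: x0; rewrite xE NegzE mulrNz mulNr oppr_ge0 leNgt.
    by rewrite divr_gt0 ?pow2_gt0// ltr0z.
  rewrite -pmulrn in xE.
  (* A dyadic rational approximates itself with error 0 at every level from [k] on. *)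
  exists 1%N => // N; exists (N + k)%N, (m * 2 ^ N)%N, (2 ^ (N + k))%N; split => //.
  - exact: leq_addr.
  - rewrite mulnC expnD leq_pmul2l ?expn_gt0// -(@ler_nat R) natrX.
    by move: x1; rewrite xE ler_pdivrMr ?pow2_gt0// mul1r.
  - by rewrite mul1n.
  - have -> : (m * 2 ^ N)%:R / 2 ^+ (N + k) = x.
      rewrite xE natrM natrX exprD; have := pow2_gt0 N; have := pow2_gt0 k.
      by move: (2 ^+ N) (2 ^+ k) => u v v0 u0; field; rewrite !gt_eqF.
    by rewrite subrr normr0 ltW// pow2V_gt0.
move=> /lt0e_dense [c c0 cl].
pose K := (Num.truncn (2 / c)).+1.
have Kc : 2 / c < K%:R by exact: truncnS_gt.
exists K => // N.
have [[|n] Nn] := limn_esup_gtP cl N.+1; first by [].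
rewrite lte_pdivlMr ?pow2_gt0// => /ereal_sup_gt [_ [r /= ar <-]].
rewrite -EFinM lte_fin => cr.
have [m mn xm] := run_approx ax ar.
exists n, m, (n + r).+1; split => //.
rewrite -(@ler_nat R) natrM natrX.
move: cr Kc; rewrite ltr_pdivrMr// exprS -[(n + r).+1]addSn natrD.
have := @ler0n R n.+1; have := @ler0n R r; have := pow2_gt0 n.
move: (2 ^+ n) (r%:R) (n.+1%:R) (K%:R) => u v w z; nra.
Qed.

Lemma truncn_double (y : R) : 0 <= y -> (Num.truncn (2 * y))./2 = Num.truncn y.
Proof.
move=> y0; apply/esym/truncn_def.
have y20 : 0 <= 2 * y by lra.
have /andP[] := truncn_itv y20.
set t := Num.truncn _.
have -> : t%:R = (odd t)%:R + t./2%:R * 2 :> R.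
  by rewrite -natrM -natrD muln2 odd_double_half.
rewrite -[t.+1%:R]natr1.
have -> : t%:R = (odd t)%:R + t./2%:R * 2 :> R.
  by rewrite -natrM -natrD muln2 odd_double_half.
rewrite -[t./2.+1%:R]natr1.
by case: (odd t) => /=; move: (t./2%:R) => z; lra.
Qed.

(** Halving the integer part of [2^(N+1) x] gives that of [2^N x], with the new digit as
    remainder. *)
Lemma greedy_sum x N : 0 <= x < 1 ->
  binary_sum (fun k => odd (Num.truncn (2 ^+ k * x))) 0 N = (Num.truncn (2 ^+ N * x))%:R / 2 ^+ N.
Proof.
move=> /andP[x0 x1]; elim: N => [|N IH].
  rewrite /binary_sum big_geq// expr0 mul1r divr1.
  by apply/esym/eqP; rewrite pnatr_eq0 -leqn0 truncn_le_nat.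
rewrite binary_sumS// IH.
rewrite -[in RHS](odd_double_half (Num.truncn (2 ^+ N.+1 * x))).
have -> : (Num.truncn (2 ^+ N.+1 * x))./2 = Num.truncn (2 ^+ N * x).
  by rewrite exprS -mulrA truncn_double// mulr_ge0 ?exprn_ge0.
rewrite natrD mulrDl addrC; congr (_ + _).
by rewrite -muln2 natrM exprS invfM mulrA mulfK.
Qed.

Lemma greedy_expansion x : 0 <= x < 1 ->
  dyadic_expansion (fun k => odd (Num.truncn (2 ^+ k * x))) x.
Proof.
move=> x01; rewrite /dyadic_expansion.
apply: (@squeeze_cvgr _ _ _ _ (fun N => x - (2 ^+ N)^-1) (fun=> x)).
- near=> N; rewrite -/(binary_sum _ 0 N) greedy_sum//.
  have h : 0 <= 2 ^+ N * x by rewrite mulr_ge0 ?exprn_ge0//; lra.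
  have /andP[h1 h2] := truncn_itv h.
  rewrite ler_pdivrMr ?pow2_gt0// [x * _]mulrC h1 andbT.
  rewrite lerBlDr -[X in _ + X]mul1r -mulrDl ler_pdivlMr ?pow2_gt0//.
  by rewrite [x * _]mulrC natr1 ltW.
- rewrite -[X in _ --> X]subr0; apply: cvgB; first exact: cvg_cst.
  have -> : (fun N : nat => (2 ^+ N)^-1 : R) = (fun N => 2^-1 ^+ N).
    by apply/funext => N; rewrite exprVn.
  by apply: cvg_expr; rewrite ger0_norm; lra.
- exact: cvg_cst.
Unshelve. all: by end_near. Qed.

Lemma ones_expansion : dyadic_expansion (fun=> true) (1 : R).
Proof.
rewrite /dyadic_expansion.
have E N : binary_sum (fun=> true) 0 N = 1 - (2 ^+ N)^-1.
  elim: N => [|N IH]; first by rewrite /binary_sum big_geq// expr0 invr1 subrr.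
  by rewrite binary_sumS// IH pow2VS mul1r; lra.
have -> : (fun N : nat => \sum_(1 <= k < N.+1) true%:R / 2 ^+ k : R) = (fun N => 1 - 2^-1 ^+ N).
  by apply/funext => N; rewrite exprVn -E.
rewrite -[X in _ --> X]subr0; apply: cvgB; first exact: cvg_cst.
by apply: cvg_expr; rewrite ger0_norm; lra.
Qed.

(** A one-sided converse of [dobinski_approx]: if [x] is not dyadic, the [2 ^ n] digits after the
    [n]-th vanish. A dyadic [x] has infinite runs by convention. *)
Lemma dobinski_of_close x : 0 <= x <= 1 ->
  (forall N, exists n m, (N <= n)%N /\
    m%:R / 2 ^+ n <= x <= m%:R / 2 ^+ n + (2 ^+ (n + 2 ^ n))^-1) ->
  dobinski R x.
Proof.
move=> x01 H; split => //.
(* The greedy digits of 1 vanish from index 1 on, so 1 takes the expansion with all digits equal to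
   1. *)
have [a ax agreedy] : exists2 a, dyadic_expansion a x &
    x < 1 -> a = (fun k => odd (Num.truncn (2 ^+ k * x))).
  have [x1|x1] := ltP x 1.
    by eexists; [apply: greedy_expansion; lra|].
  have -> : x = 1 by lra.
  by exists (fun=> true); [exact: ones_expansion|].
exists a; split => //.
(* The run at index [n + 1] has length at least [2^n - 1], and [(2^n - 1) / 2^(n+1) >= 1/4] once
   [n >= 1], which [H N.+1] ensures. *)
apply: (@lt_le_trans _ _ (1 / 4)%:E); first by rewrite lte_fin; lra.
apply: limn_esup_geP => N; rewrite /dyadic_run; case: asboolP => [_|xnd].
  by exists N => //; rewrite gt0_mulye ?leey// lte_fin pow2V_gt0.
have x1 : x < 1.
  rewrite lt_neqAle; case/andP: x01 => _ ->; rewrite andbT; apply/eqP => x1.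
  by apply: xnd; exists 1, 0%N; rewrite expr0 divr1.
have [n [m [Nn /andP[mx xm]]]] := H N.+1.
exists n.+1; first by rewrite leqW// ltnW.
have n2 : (0 < 2 ^ n)%N by rewrite expn_gt0.
(* Strictness matters: at the right end of the window the digit of index [n + 2^n] is 1. *)
have xm' : x < m%:R / 2 ^+ n + (2 ^+ (n + 2 ^ n))^-1.
  rewrite lt_neqAle xm andbT; apply/eqP => xE; apply: xnd.
  exists (Posz (m * 2 ^ (2 ^ n) + 1)), (n + 2 ^ n)%N.
  rewrite xE -pmulrn natrD natrM natrX exprD mulrDl mul1r; congr (_ + _).
  by rewrite invfM mulrACA divff ?mulr1// gt_eqF// pow2_gt0.
have digit k : (k < 2 ^ n)%N -> a (n.+1 + k)%N = false.
  move=> kn; rewrite agreedy//.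
  have -> : Num.truncn (2 ^+ (n.+1 + k) * x) = (m * 2 ^ k.+1)%N.
    apply: truncn_def.
    have -> : (m * 2 ^ k.+1).+1%:R = m%:R * 2 ^+ k.+1 + 1 :> R.
      by rewrite -[LHS]natr1 natrM natrX.
    rewrite natrM natrX addSnnS exprD.
    have e1 : 2 ^+ n * (m%:R / 2 ^+ n) = m%:R :> R.
      by rewrite mulrC mulfVK// gt_eqF// pow2_gt0.
    rewrite exprD in xm'.
    have u0 := pow2_gt0 n; have v0 := pow2_gt0 k.+1.
    have vw : 2 ^+ k.+1 <= 2 ^+ (2 ^ n) :> R by rewrite ler_eXn2l// ltr1n.
    move: mx xm' vw; move: (2 ^+ n) u0 (2 ^+ k.+1) v0 (2 ^+ (2 ^ n)) => u u0 v v0 w.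
    rewrite ler_pdivrMr// => h1 h2 vw.
    have w0 : 0 < w by lra.
    have : u * x < m%:R + w^-1.
      have -> : m%:R + w^-1 = u * (m%:R / u + (u * w)^-1) by field; rewrite !gt_eqF.
      by rewrite ltr_pM2l.
    rewrite -ltrBlDl -(ltr_pM2r w0) mulVf ?gt_eqF// => h3.
    have h4 : 0 <= u * x - m%:R by lra.
    have h5 : (u * x - m%:R) * v <= (u * x - m%:R) * w by rewrite ler_wpM2l.
    have h6 := le_lt_trans h5 h3; rewrite mulrBl in h6.
    rewrite mulrAC ler_pM2r//; move: h4 h6; rewrite subr_ge0 => -> /=.
    by rewrite ltrBlDl.
  by rewrite expnS mulnCA mul2n odd_double.
apply: (@le_trans _ _ ((2 ^ n).-1%:R%:E * (2 ^+ n.+1)^-1%:E)%E).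
  rewrite -EFinM lee_fin ler_pdivlMr ?pow2_gt0// exprS.
  rewrite -subn1 natrB// natrX.
  have : 2 ^+ 1 <= 2 ^+ n :> R by rewrite ler_eXn2l ?ltr1n// (leq_ltn_trans _ Nn).
  rewrite expr1.
  lra.
apply: lee_wpmul2r; first by rewrite lee_fin ltW// pow2V_gt0.
apply: ereal_sup_ubound; exists (2 ^ n).-1 => // j /= jn.
have := digit 0%N n2; rewrite addn0 => ->; apply: digit.
by rewrite (leq_ltn_trans jn)// ltn_predL.
Qed.

End binary.

(** * The case p > 2 *)

Section small_capacity.
Variable R : realType.
Local Notation mu := (@lebesgue_measure R).
Local Notation I01 := (`[0%R, 1%R]%classic : set R).

Lemma bernoulli_ineq (h : R) n : 0 <= h -> 1 + n%:R * h <= (1 + h) ^+ n.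
Proof.
move=> h0; elim: n => [|n IH]; first by rewrite mul0r addr0 expr0.
rewrite exprS -natr1 mulrDl mul1r.
have := ler0n R n; have : 0 <= n%:R * h by rewrite mulr_ge0.
by move: IH; move: ((1 + h) ^+ n) (n%:R) => u v; nra.
Qed.

Lemma expr_unbounded (z A : R) : 1 < z -> exists N, forall n, (N <= n)%N -> A <= z ^+ n.
Proof.
move=> z1; exists (Num.truncn (A / (z - 1))).+1 => n Nn.
have h : 0 < z - 1 by lra.
have := bernoulli_ineq n (ltW h).
have -> : 1 + (z - 1) = z by lra.
apply: le_trans.
have : A / (z - 1) <= n%:R.
  by rewrite (le_trans (ltW (truncnS_gt _)))// ler_nat.
by rewrite ler_pdivrMr//; lra.
Qed.

Lemma geometric_partial_le (z : R) N : 0 <= z < 1 -> \sum_(n < N) z ^+ n <= (1 - z)^-1.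
Proof.
move=> z01; rewrite -[leRHS]mul1r ler_pdivlMr; last lra.
have -> : (\sum_(n < N) z ^+ n) * (1 - z) = 1 - z ^+ N.
  elim: N => [|N IH]; first by rewrite big_ord0 mul0r expr0 subrr.
  by rewrite big_ord_recr/= mulrDl IH exprS; ring.
have : 0 <= z ^+ N by rewrite exprn_ge0//; lra.
lra.
Qed.

Local Open Scope ereal_scope.

Lemma gt1_powR (a x : R) : (1 < a)%R -> (0 < x)%R -> (1 < a `^ x)%R.
Proof.
move=> a1 x0; have := @gt0_ltr_powR R x x0 1%R a.
by rewrite !nnegrE powR1; apply => //; lra.
Qed.

(** With [U] the dyadic kernel, [U <= 2 / max x 2^(-J)] gives [d <= 9 max x 2^(-J) <= 18 / U], so
    [d^(-b) >= (U / 18)^b >= U^b / 18]. For [b = 1 - 1/p], the Riesz kernel thus turns the [p]-th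
    root of [U] back into [U]. *)
Lemma dyadic_kernel_le_rkernel (b x d : R) J : (0 <= b <= 1)%R -> (0 <= x)%R ->
  (0 <= d <= 8 * (2 ^+ J)^-1 + x)%R ->
  (dyadic_kernel J x / 18)%:E <= (dyadic_kernel J x `^ (1 - b))%:E * rkernel b d.
Proof.
move=> /andP[b0 b1] x0 /andP[d0 dx]; have := dyadic_kernel_max_le2 J x0.
have := dyadic_kernel_ge0 J x; set U := dyadic_kernel J x.
rewrite le_eqVlt => /predU1P[<- _|U0 hU].
  by rewrite mul0r mule_ge0 ?rkernel_ge0// lee_fin powR_ge0.
have d18 : (d <= 18 / U)%R.
  rewrite ler_pdivlMr//; apply: le_trans (_ : 9 * (U * Num.max x (2 ^+ J)^-1) <= 18)%R; last lra.
  rewrite mulrCA [(d * U)%R]mulrC ler_pM2l// (le_trans dx)//.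
  have : (x <= Num.max x (2 ^+ J)^-1)%R by rewrite le_max lexx.
  have : ((2 ^+ J)^-1 <= Num.max x (2 ^+ J)^-1)%R by rewrite le_max lexx orbT.
  lra.
have U18 : (0 < 18 / U)%R by rewrite divr_gt0.
apply: (@le_trans _ _ ((U `^ (1 - b))%:E * rkernel b (18 / U))); last first.
  by apply: lee_wpmul2l; [rewrite lee_fin powR_ge0|apply: rkernel_le => //; rewrite d0].
rewrite rkernelE// -EFinM lee_fin.
rewrite powRM ?invr_ge0 ?(ltW U0)// -(@powR_inv1 _ U) ?(ltW U0)// -[((U `^ (-1)) `^ _)%R]powRrM mulN1r opprK.
rewrite mulrCA -powRD ?subrK ?(gt_eqF U0) ?implybT//.
rewrite powRr1 ?(ltW U0)// mulrC ler_wpM2r ?(ltW U0)//.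
rewrite powRN lef_pV2 ?posrE ?powR_gt0//.
by apply: ler1_powR => //; lra.
Qed.

Variable p : R.
Hypothesis p2 : (2 < p)%R.

(* Any q with 2^-p < q < 1/4 works: 4 q < 1 makes the total mass of the weight
   finite, while 2 q^(1/p) > 1 makes the potential of its p-th root unbounded
   along the approximations of a point of the Dobinski set. *)
Definition dobinski_decay : R := (2 `^ (- (1 + p / 2)))%R.
Local Notation q := dobinski_decay.
Definition dobinski_decay_root : R := (q `^ p^-1)%R.
Local Notation s := dobinski_decay_root.

Lemma dobinski_decay_gt0 : (0 < q)%R. Proof. by rewrite powR_gt0. Qed.

Lemma dobinski_decay_root_gt0 : (0 < s)%R. Proof. by rewrite !powR_gt0. Qed.

Lemma dobinski_decay_lt : (4 * q < 1)%R.
Proof.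
have -> : (4 = 2 `^ 2%:R :> R)%R by rewrite powR_mulrn// expr2; lra.
rewrite /dobinski_decay -powRD ?pnatr_eq0 ?implybT//.
have -> : (2%:R - (1 + p / 2) = - (p / 2 - 1) :> R)%R by lra.
by rewrite powRN invf_lt1 ?powR_gt0// gt1_powR//; have := p2; lra.
Qed.

Lemma dobinski_decay_root_gt : (1 < 2 * s)%R.
Proof.
have p0 : (0 < p)%R by apply: lt_trans p2.
rewrite -[X in (X * _)%R]powRr1// /dobinski_decay_root /dobinski_decay -powRrM -powRD ?pnatr_eq0 ?implybT//.
apply: gt1_powR; first lra.
have -> : (1 + - (1 + p / 2) / p = (p - 2) / (2 * p))%R by field; rewrite gt_eqF.
by rewrite divr_gt0//; have := p2; lra.
Qed.

(** The sum is taken on [p]-th powers: the energy is then additive over levels and centres, while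
    the potential estimate only has to keep one term of the sum. *)
Definition dobinski_weight (z : R * R) : \bar R :=
  \sum_(n <oo) (\sum_(m < (2 ^ n).+1)
    q ^+ n * dyadic_kernel (2 ^ n) (eucl_dist z (expi (m%:R / 2 ^+ n))))%:E.

Local Notation W := dobinski_weight.

Lemma dobinski_term_ge0 n z : (0 <= \sum_(m < (2 ^ n).+1)
    q ^+ n * dyadic_kernel (2 ^ n) (eucl_dist z (expi (m%:R / 2 ^+ n))))%R.
Proof.
by apply: sumr_ge0 => m _; rewrite mulr_ge0 ?exprn_ge0 ?(ltW dobinski_decay_gt0) ?dyadic_kernel_ge0.
Qed.

Lemma dobinski_weight_ge0 z : 0 <= W z.
Proof. by apply: nneseries_ge0 => n _ _; rewrite lee_fin dobinski_term_ge0. Qed.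

Lemma measurable_dobinski_term n : measurable_fun setT (fun z => (\sum_(m < (2 ^ n).+1)
    q ^+ n * dyadic_kernel (2 ^ n) (eucl_dist z (expi (m%:R / 2 ^+ n))))%:E).
Proof.
apply/measurable_EFinP; apply: measurable_sum => m.
apply: measurable_funM => //.
apply: (measurableT_comp (f := dyadic_kernel (2 ^ n))).
  exact: measurable_dyadic_kernel.
exact: measurable_eucl_dist.
Qed.

Lemma measurable_dobinski_weight : measurable_fun setT W.
Proof.
apply: (@ge0_emeasurable_sum _ _ _ _ (fun n z => (\sum_(m < (2 ^ n).+1)
    q ^+ n * dyadic_kernel (2 ^ n) (eucl_dist z (expi (m%:R / 2 ^+ n))))%:E) xpredT).
  by move=> n z _ _; rewrite lee_fin dobinski_term_ge0.
by move=> n _; exact: measurable_dobinski_term.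
Qed.

Lemma measurable_dyadic_kernel_chord J (x : R) :
  measurable_fun setT (fun t : R => dyadic_kernel J (chord t x)).
Proof.
apply: (measurableT_comp (f := dyadic_kernel J)); first exact: measurable_dyadic_kernel.
exact: measurable_chord.
Qed.

Lemma dyadic_point01 n (m : 'I_(2 ^ n).+1) : (0 <= (m%:R / 2 ^+ n : R) <= 1)%R.
Proof.
rewrite divr_ge0 ?exprn_ge0//= ler_pdivrMr ?pow2_gt0// mul1r -natrX ler_nat.
by rewrite -ltnS.
Qed.

(** Each of the [J] scales contributes a bounded amount, a height [2^j] on a set of measure of order
    [2^(-j)]; the lower bound that follows is the same count. *)
Lemma integral_dyadic_kernel_chord_le J (x : R) : (0 <= x <= 1)%R ->
  \int[mu]_(t in I01) (dyadic_kernel J (chord t x))%:E <= (4 * J%:R)%:E.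
Proof.
move=> x01; rewrite integral_dyadic_kernel//; last exact: measurable_chord.
have -> : (4 * J%:R)%:E = \sum_(j < J) (4%:E : \bar R).
  by rewrite sumEFin sumr_const card_ord mulr_natr.
apply: lee_sum => j _.
apply: (@le_trans _ _ ((2 ^+ j)%:E * (4 * (2 ^+ j)^-1)%:E)).
  by apply: lee_wpmul2l; [rewrite lee_fin exprn_ge0|apply: measure_chord_le => //; exact: ltW (pow2V_gt0 _ _)].
by rewrite -EFinM lee_fin mulrCA divff ?mulr1// gt_eqF// pow2_gt0.
Qed.

Lemma integral_dyadic_kernel_chord_ge J (x : R) : (0 <= x <= 1)%R ->
  (J%:R / 8)%:E <= \int[mu]_(t in I01) (dyadic_kernel J (chord t x))%:E.
Proof.
move=> x01; rewrite integral_dyadic_kernel//; last exact: measurable_chord.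
have -> : (J%:R / 8)%:E = \sum_(j < J) ((8^-1)%:E : \bar R).
  by rewrite sumEFin sumr_const card_ord mulr_natl.
apply: lee_sum => j _.
apply: (@le_trans _ _ ((2 ^+ j)%:E * ((2 ^+ j)^-1 / 8)%:E)).
  by rewrite -EFinM lee_fin mulrA divff ?mul1r// gt_eqF// pow2_gt0.
apply: lee_wpmul2l; first by rewrite lee_fin exprn_ge0.
apply: measure_chord_ge => //; rewrite ltW ?pow2V_gt0//= invf_le1 ?pow2_gt0//.
by rewrite exprn_ege1//; lra.
Qed.

Lemma integral_dobinski_weight :
  \int[circle_measure R]_(z in circle R) W z <= (8 / (1 - 4 * q))%:E.
Proof.
rewrite ge0_integral_circle; first last.
- by move=> z _; exact: dobinski_weight_ge0.
- by apply: measurable_funTS; exact: measurable_dobinski_weight.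
pose F n (t : R) := (\sum_(m < (2 ^ n).+1)
    q ^+ n * dyadic_kernel (2 ^ n) (chord t (m%:R / 2 ^+ n)))%:E.
have mF n : measurable_fun I01 (F n).
  apply: measurable_funTS.
  exact: (measurableT_comp (measurable_dobinski_term n) (@measurable_expi R)).
have F0 n t : I01 t -> 0 <= F n t by move=> _; rewrite lee_fin; exact: (dobinski_term_ge0 n (expi t)).
rewrite [leLHS](_ : _ = \int[mu]_(t in I01) \sum_(n <oo) F n t)//.
rewrite integral_nneseries//.
(* There are [2^n + 1 <= 2 * 2^n] centres, each of mass at most [q^n * 4 * 2^n]. *)
have Fle n : \int[mu]_(t in I01) F n t <= (8 * (4 * q) ^+ n)%:E.
  rewrite /F; under eq_integral do rewrite -sumEFin.
  have mk (m : 'I_(2 ^ n).+1) : measurable_fun I01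
      (fun t => (dyadic_kernel (2 ^ n) (chord t (m%:R / 2 ^+ n)))%:E).
    apply/measurable_EFinP; apply: measurable_funTS.
    exact: measurable_dyadic_kernel_chord.
  under eq_integral do under eq_bigr do rewrite EFinM.
  rewrite ge0_integral_sum//.
  - apply: (@le_trans _ _ (\sum_(m < (2 ^ n).+1) (q ^+ n * (4 * (2 ^ n)%:R))%:E)).
      apply: lee_sum => m _; rewrite ge0_integralZl//; first last.
      + by rewrite lee_fin exprn_ge0 // ltW // dobinski_decay_gt0.
      + by move=> t _; rewrite lee_fin dyadic_kernel_ge0.
      + exact: mk.
      + rewrite EFinM; apply: lee_wpmul2l; first by rewrite lee_fin exprn_ge0 // ltW // dobinski_decay_gt0.
        by apply: integral_dyadic_kernel_chord_le; exact: dyadic_point01.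
    have en : ((2 ^ n).+1%:R = 2 ^+ n + 1 :> R)%R by rewrite -natr1 natrX.
    rewrite sumEFin sumr_const card_ord lee_fin -[X in (X <= _)%R]mulr_natr en natrX exprMn.
    have -> : (4 = 2 * 2 :> R)%R by lra.
    rewrite exprMn.
    have : (0 <= q ^+ n)%R by rewrite exprn_ge0// ltW// dobinski_decay_gt0.
    have : (1 <= 2 ^+ n :> R)%R by rewrite exprn_ege1//; lra.
    move: (2 ^+ n)%R (q ^+ n)%R => u v u1 v0.
    have : (0 <= u * v * (u - 1))%R by rewrite !mulr_ge0//; lra.
    lra.
  - by move=> m; apply: measurable_funeM; exact: mk.
  - move=> m t _; rewrite -EFinM lee_fin mulr_ge0 ?dyadic_kernel_ge0//.
    by rewrite exprn_ge0// ltW// dobinski_decay_gt0.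
apply: (@le_trans _ _ (\sum_(n <oo) (8 * (4 * q) ^+ n)%:E)).
  by apply: lee_nneseries => // n _ _; apply: integral_ge0 => t; exact: F0.
apply: lime_le.
  apply: is_cvg_nneseries => n _ _; rewrite lee_fin mulr_ge0// exprn_ge0//.
  by have := dobinski_decay_gt0; lra.
apply: nearW => N; rewrite big_mkord sumEFin lee_fin -mulr_sumr.
by rewrite ler_wpM2l// geometric_partial_le//; have := dobinski_decay_gt0; have := dobinski_decay_lt; lra.
Qed.

Definition dobinski_test (e : R) (z : R * R) : \bar R := e%:E * (W z) `^ p^-1.

Local Notation b := (1 - p^-1)%R.

Lemma riesz_potentialE (a : R) (f : R * R -> \bar R) (x : R) :
  measurable_fun (circle R) f -> (forall z, circle R z -> 0 <= f z) ->
  riesz_potential a f (expi x) =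
  \int[mu]_(t in I01) (f (expi t) * rkernel (1 - a) (chord x t)).
Proof.
move=> mf f0; rewrite /riesz_potential.
pose g z := f z * rkernel (1 - a) (eucl_dist (expi x) z).
rewrite [LHS](_ : _ = \int[circle_measure R]_(y in circle R) g y)//.
rewrite ge0_integral_circle//.
- apply: emeasurable_funM => //; apply: measurable_funTS.
  apply: (measurableT_comp (measurable_rkernel _)).
  rewrite [X in measurable_fun _ X](_ : _ = (fun z => eucl_dist z (expi x))).
    exact: measurable_eucl_dist.
  apply/funext => z; rewrite /eucl_dist.
  by rewrite -[((expi x).1 - _)%R]opprB -[((expi x).2 - _)%R]opprB !sqrrN.
- by move=> z cz; rewrite mule_ge0 ?f0// rkernel_ge0.
Qed.

Lemma dobinski_test_admissible e : (0 < e)%R ->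
  riesz_admissible p^-1 (dobinski_circle R) (dobinski_test e).
Proof.
move=> e0.
have mf : measurable_fun (circle R) (dobinski_test e).
  apply: measurable_funTS; apply: measurable_funeM.
  exact: (measurableT_comp (measurable_poweR p^-1) measurable_dobinski_weight).
have f0 z : circle R z -> 0 <= dobinski_test e z.
  by move=> _; rewrite mule_ge0 ?poweR_ge0// lee_fin ltW.
split => // _ [x Dx <-]; rewrite riesz_potentialE//.
have x01 : (0 <= x <= 1)%R by case: Dx.
have [K K0 HK] := dobinski_approx Dx.
(* [144 = 18 * 8]: 18 from [dyadic_kernel_le_rkernel], 8 from [integral_dyadic_kernel_chord_ge]. *)
have [N HN] := expr_unbounded (144 * K%:R / e) dobinski_decay_root_gt.
have [n [m [j [Nn mn nKj xm]]]] := HK N.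
(* The weight has [2 ^ n] scales at level [n], but [x] is known to be close to the centre only up to
   scale [j]; the common scales still satisfy [2 ^ n <= K * J]. *)
pose J := minn j (2 ^ n).
have nKJ : (2 ^ n <= K * J)%N.
  by rewrite /J /minn; case: ifPn => // _; rewrite leq_pmull.
have Jj : ((2 ^+ j)^-1 <= (2 ^+ J)^-1 :> R)%R.
  by rewrite lef_pV2 ?posrE ?pow2_gt0// ler_eXn2l ?ltr1n// geq_minl.
pose xn : R := (m%:R / 2 ^+ n)%R.
have mn' : (m < (2 ^ n).+1)%N by rewrite ltnS.
have xn01 : (0 <= xn <= 1)%R := dyadic_point01 (Ordinal mn').
pose c : R := (e * s ^+ n / 18)%R.
have c0 : (0 <= c)%R by rewrite divr_ge0// mulr_ge0 ?exprn_ge0 ?ltW ?dobinski_decay_root_gt0.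
have mU : measurable_fun I01 (fun t => (dyadic_kernel J (chord t xn))%:E).
  apply/measurable_EFinP; apply: measurable_funTS.
  exact: measurable_dyadic_kernel_chord.
apply: (@le_trans _ _ (\int[mu]_(t in I01) (c%:E * (dyadic_kernel J (chord t xn))%:E))).
  rewrite ge0_integralZl//; last by move=> t _; rewrite lee_fin dyadic_kernel_ge0.
  apply: (@le_trans _ _ (c%:E * (J%:R / 8)%:E)); last first.
    by apply: lee_wpmul2l; [rewrite lee_fin|exact: integral_dyadic_kernel_chord_ge].
  rewrite -EFinM lee_fin /c.
  have := HN n Nn; rewrite ler_pdivrMr// exprMn.
  have : (2 ^+ n <= K%:R * J%:R :> R)%R by rewrite -natrX -natrM ler_nat.
  have K1 : (1 <= K%:R :> R)%R by rewrite ler1n.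
  have sn : (0 < s ^+ n)%R by rewrite exprn_gt0// dobinski_decay_root_gt0.
  move=> h1 h2.
  have h3 : (2 ^+ n * s ^+ n * e <= K%:R * J%:R * s ^+ n * e)%R by rewrite ler_pM2r// ler_pM2r.
  have h4 : (144 * K%:R <= K%:R * (J%:R * s ^+ n * e))%R by rewrite !mulrA in h3 *; exact: le_trans h2 h3.
  rewrite [(144 * _)%R]mulrC ler_pM2l in h4; last lra.
  lra.
apply: ge0_le_integral => //.
- by move=> t _; rewrite -EFinM lee_fin mulr_ge0// dyadic_kernel_ge0.
- exact: measurable_funeM.
- apply: emeasurable_funM.
    by apply: measurable_funTS; exact: measurable_comp_expi.
  apply: measurable_funTS; under eq_fun do rewrite chordC.
  exact: (measurableT_comp (measurable_rkernel b) (measurable_chord x)).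
move=> t _; set U := dyadic_kernel J _.
have U0 : (0 <= U)%R by exact: dyadic_kernel_ge0.
have WU : ((q ^+ n * U)%:E <= W (expi t)).
  apply: le_trans (nneseries_term_le n _); last by move=> k; rewrite lee_fin dobinski_term_ge0.
  rewrite lee_fin (bigD1 (Ordinal mn'))//= -[leLHS]addr0 lerD//.
    rewrite ler_wpM2l ?exprn_ge0 ?(ltW dobinski_decay_gt0)//.
    by apply: dyadic_kernel_nd; exact: geq_minr.
  by apply: sumr_ge0 => i _; rewrite mulr_ge0 ?exprn_ge0 ?(ltW dobinski_decay_gt0) ?dyadic_kernel_ge0.
have pV : (0 < p^-1)%R by rewrite invr_gt0 (lt_trans _ p2).
apply: (@le_trans _ _ ((e%:E * (q ^+ n * U)%:E `^ p^-1) * rkernel b (chord x t))); last first.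
  apply: lee_wpmul2r; first exact: rkernel_ge0.
  apply: lee_wpmul2l; first by rewrite lee_fin ltW.
  apply: gt0_ler_poweR; rewrite ?in_itv/= ?leey ?andbT ?lee_fin ?(ltW pV)//.
    by rewrite mulr_ge0// exprn_ge0// ltW// dobinski_decay_gt0.
  exact: dobinski_weight_ge0.
rewrite poweR_EFin powRM ?exprn_ge0 ?(ltW dobinski_decay_gt0)//.
have -> : ((q ^+ n) `^ p^-1 = s ^+ n)%R.
  by rewrite -(powR_mulrn n (ltW dobinski_decay_gt0)) powRAC powR_mulrn// powR_ge0.
rewrite !EFinM -!muleA.
rewrite -[_%:E * U%:E]EFinM [(18^-1 * U)%R]mulrC; apply: lee_wpmul2l; first by rewrite lee_fin ltW.
apply: lee_wpmul2l; first by rewrite lee_fin exprn_ge0// ltW// dobinski_decay_root_gt0.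
have := @dyadic_kernel_le_rkernel b (chord t xn) (chord x t) J.
rewrite subKr -/U; apply; rewrite ?chord_ge0//=.
  have : (p^-1 <= 1)%R.
    by rewrite invf_le1 ?(lt_trans _ p2)//; have := p2; lra.
  by move: pV; lra.
apply: (le_trans (chord_triangle xn x t)); rewrite [chord xn t]chordC lerD2r.
by rewrite (le_trans (chord_le _ _))// ler_pM2l// (le_trans xm).
Qed.

Theorem riesz_capacity_dobinski_circle0 : riesz_capacity p^-1 p (dobinski_circle R) = 0.
Proof.
apply/eqP; rewrite eq_le; apply/andP; split; last first.
  by apply: le_ereal_inf_tmp => _ [f _ <-]; apply: integral_ge0 => z _; exact: poweR_ge0.
have p0 : (p != 0)%R by rewrite gt_eqF// (lt_trans _ p2).
apply/lee_addgt0Pr => d d0; rewrite add0e.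
pose C : R := (8 / (1 - 4 * q))%R.
have C0 : (0 < C)%R by rewrite divr_gt0// subr_gt0 dobinski_decay_lt.
(* At this scale the energy is [d / C] times the total weight, hence at most [d]. *)
pose e : R := ((d / C) `^ p^-1)%R.
have dC0 : (0 <= d / C)%R by rewrite divr_ge0// ltW.
have e0 : (0 < e)%R by rewrite powR_gt0// divr_gt0.
apply: (@le_trans _ _ (\int[circle_measure R]_(y in circle R) (dobinski_test e y `^ p))).
  by apply: ereal_inf_lbound; exists (dobinski_test e) => //; exact: dobinski_test_admissible.
have E z : dobinski_test e z `^ p = (d / C)%:E * W z.
  rewrite /dobinski_test poweRM ?poweR_ge0 ?lee_fin ?(ltW e0)//.
  rewrite poweR_EFin /e -powRrM -poweRrM mulVf// powRr1//.
  by rewrite poweRe1 ?dobinski_weight_ge0.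
rewrite [leLHS](_ : _ = \int[circle_measure R]_(y in circle R) ((d / C)%:E * W y)); last first.
  by apply: eq_integral => z _; exact: E.
rewrite ge0_integralZl//.
- apply: (@le_trans _ _ ((d / C)%:E * C%:E)).
    by apply: lee_wpmul2l; [rewrite lee_fin|exact: integral_dobinski_weight].
  by rewrite -EFinM divfK// gt_eqF.
- exact: measurable_circle.
- by apply: measurable_funTS; exact: measurable_dobinski_weight.
- by move=> z _; exact: dobinski_weight_ge0.
Qed.

End small_capacity.

(** * Local estimates for potentials *)

Section potential.
Variable R : realType.
Local Notation mu := (@lebesgue_measure R).
Local Notation I01 := (`[0%R, 1%R]%classic : set R).
Local Open Scope ereal_scope.

(** * Stability and averages of the kernel *)

Section kernel_bounds.
Variable b : R.
Hypothesis b0 : (0 <= b <= 1 / 2)%R.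

Lemma measurable_rkernel_chord (s : R) :
  measurable_fun setT (fun t : R => rkernel b (chord t s)).
Proof. exact: (measurableT_comp (measurable_rkernel b) (measurable_chord s)). Qed.

Lemma rkernel_scale (c d : R) : (0 < c <= 1)%R -> (0 < d)%R ->
  rkernel b (c * d) <= (c^-1)%:E * rkernel b d.
Proof.
move=> /andP[c0 c1] d0; rewrite !rkernelE ?mulr_gt0// -EFinM lee_fin.
rewrite powRM ?(ltW c0) ?(ltW d0)// ler_wpM2r ?powR_ge0//.
rewrite powRN lef_pV2 ?posrE ?powR_gt0//.
by apply: ger1_powR; [rewrite c0|have := b0; lra].
Qed.

(** Moving [x0] by [th] changes the chord to [t] by at most [8 * th], a fraction at most [8 / L] of
    it. *)
Lemma rkernel_far (L th x0 s t : R) : (8 < L)%R -> (0 < th)%R ->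
  (`|s - x0| <= th)%R -> (L * th <= chord x0 t)%R ->
  rkernel b (chord s t) <= ((1 - 8 / L)^-1)%:E * rkernel b (chord x0 t).
Proof.
move=> L8 th0 sx h.
have L0 : (0 < L)%R by lra.
have L1 : (8 / L < 1)%R by rewrite ltr_pdivrMr// mul1r.
have L2 : (0 < 8 / L)%R by rewrite divr_gt0.
have d0 : (0 < chord x0 t)%R by rewrite (lt_le_trans _ h)// mulr_gt0.
apply: le_trans (rkernel_scale _ d0); last by apply/andP; split; lra.
apply: rkernel_le; first by have := b0; lra.
rewrite mulr_ge0 ?(ltW d0)//=; last lra.
have h1 := chord_triangle s x0 t; have h2 := chord_le x0 s.
rewrite distrC in h2.
have h3 : (8 * th <= 8 / L * chord x0 t)%R.
  by rewrite -mulrA ler_pM2l// ler_pdivlMl.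
lra.
Qed.

Lemma chord_ge_dist (s t : R) : (0 <= s <= 1)%R -> (0 <= t <= 1)%R ->
  (`|s - t| <= 1 / 2)%R -> (`|s - t| <= chord s t)%R.
Proof.
move=> s01 t01 st; apply: le_trans (chord_ge s01 t01).
by rewrite le_min lexx/=; lra.
Qed.

(** The bounds on [rho] exclude points that are close to [x0] only across the junction of 0 and
    1. *)
Lemma near_dist (x0 rho t : R) : (rho < x0)%R -> (rho < 1 - x0)%R ->
  (0 <= t <= 1)%R -> (chord t x0 <= rho)%R -> (`|t - x0| <= rho)%R.
Proof.
move=> r0 r1 t01 ct.
have rho0 := le_trans (chord_ge0 t x0) ct.
have x01 : (0 <= x0 <= 1)%R by lra.
have := le_trans (chord_ge t01 x01) ct; rewrite ge_min => /orP[//|h].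
have : (`|t - x0| < 1 - rho)%R by rewrite ltr_norml; apply/andP; split; lra.
lra.
Qed.

(** Averaging truncates the singularity at [r]: if [t] is at least [2 r] away from [c], the kernel
    is at most [2 M^(-b)] on the interval; otherwise the interval lies in a ball of radius [3 r]
    around [t]. *)
Lemma integral_rkernel_dist_le (c r t : R) : (0 < r)%R ->
  \int[mu]_(s in `[c, (c + r)%R]) rkernel b `|s - t|%R <=
  (48 * r * (Num.max `|t - c| r) `^ (- b))%:E.
Proof.
move=> r0; set J := `[c, (c + r)%R]%classic.
have mJ : measurable J by exact: measurable_itv.
have mk : measurable_fun J (fun s => rkernel b `|s - t|%R).
  by apply: measurable_funTS; exact: measurable_rkernel_dist.
set M := Num.max _ _.
have M0 : (0 < M)%R by rewrite lt_max r0 orbT.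
have Mb0 : (0 <= M `^ (- b))%R by exact: powR_ge0.
have [h|h] := leP (2 * r)%R `|t - c|%R.
  have ME : M = `|t - c|%R by rewrite /M maxEle; case: ifPn => // H; lra.
  apply: (@le_trans _ _ (\int[mu]_(s in J) cst (2 * M `^ (- b))%:E s)).
    apply: ge0_le_integral => //.
    - by move=> s _; exact: rkernel_ge0.
    - move=> s; rewrite /J /= in_itv/= => sJ.
      have hs : (M / 2 <= `|s - t|)%R.
        rewrite ME; have : (`|s - c| <= r)%R by rewrite ler_distl; lra.
        have := ler_distD s t c; rewrite [`|t - s|%R]distrC; lra.
      apply: (@le_trans _ _ (rkernel b (2^-1 * M))).
        by apply: rkernel_le; [have := b0; lra|rewrite mulrC hs andbT divr_ge0// ltW].
      apply: le_trans (rkernel_scale _ M0) _; first by apply/andP; split; lra.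
      by rewrite invrK rkernelE// EFinM.
  rewrite integral_cst//= lebesgue_measure_itvcc; last by lra.
  rewrite -EFinM lee_fin; have := mulr_ge0 (ltW r0) Mb0; lra.
apply: (@le_trans _ _ (\int[mu]_(s in [set s | (`|s - t| <= 3 * r)%R]) rkernel b `|s - t|%R)).
  apply: ge0_subset_integral => //.
  - exact: measurable_le_cst (measurable_dist t).
  - by apply: measurable_funTS; exact: measurable_rkernel_dist.
  - by move=> s _; exact: rkernel_ge0.
  - move=> s; rewrite /J /= in_itv/= => sJ.
    have : (`|s - c| <= r)%R by rewrite ler_distl; lra.
    have := ler_distD c s t; rewrite [`|c - t|%R]distrC; lra.
apply: (le_trans (integral_rkernel_le _ b0 _)); first lra.
rewrite lee_fin.
have r3 : (0 < 3 * r)%R by lra.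
have -> : ((3 * r) `^ (1 - b) = 3 * r * (3 * r) `^ (- b))%R.
  by rewrite powRD ?(gt_eqF r3) ?implybT// powRr1 ?ltW.
have M3 : (M <= 3 * r)%R by rewrite ge_max; apply/andP; split; lra.
have h1 : ((3 * r) `^ (- b) <= M `^ (- b))%R.
  rewrite !powRN lef_pV2 ?posrE ?powR_gt0//.
  by rewrite ge0_ler_powR ?nnegrE ?(ltW M0) ?(ltW r3)//; have := b0; lra.
rewrite mulrA; apply: (@le_trans _ _ (8 * (3 * r) * M `^ (- b))%R).
  by rewrite ler_wpM2l// mulr_ge0// ltW.
have := mulr_ge0 (ltW r0) Mb0; lra.
Qed.

Lemma integral_rkernel_near (c r t : R) : (0 < r)%R -> (0 <= c)%R -> (c + r <= 1)%R ->
  (0 <= t <= 1)%R -> (r + `|t - c| <= 1 / 2)%R ->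
  \int[mu]_(s in `[c, (c + r)%R]) rkernel b (chord s t) <=
  (48 * r * (Num.max `|t - c| r) `^ (- b))%:E.
Proof.
move=> r0 c0 cr1 t01 h; apply: le_trans (integral_rkernel_dist_le c t r0).
apply: ge0_le_integral => //.
- by move=> s _; exact: rkernel_ge0.
- by apply: measurable_funTS; exact: measurable_rkernel_chord.
- by apply: measurable_funTS; exact: measurable_rkernel_dist.
- move=> s /=; rewrite in_itv/= => sJ.
  apply: rkernel_le; first by have := b0; lra.
  rewrite normr_ge0/=; apply: chord_ge_dist => //; first lra.
  have : (`|s - c| <= r)%R by rewrite ler_distl; lra.
  have := ler_distD c s t; rewrite [`|c - t|%R]distrC; lra.
Qed.

End kernel_bounds.

(** * Exchange of integrals for the potential *)

Section tonelli.
Variables (b : R) (F : R -> \bar R).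
Hypothesis mF : measurable_fun setT F.
Hypothesis F0 : forall t, 0 <= F t.

Definition circle_potential (s : R) : \bar R :=
  \int[mu]_(t in I01) (F t * rkernel b (chord s t)).

Lemma circle_potential_ge0 s : 0 <= circle_potential s.
Proof. by apply: integral_ge0 => t _; rewrite mule_ge0// rkernel_ge0. Qed.

Lemma measurable_integrand2 : measurable_fun setT
  (fun z : R * R => F z.2 * rkernel b (chord z.1 z.2)).
Proof.
apply: emeasurable_funM.
  exact: (measurableT_comp mF (measurable_snd)).
exact: (measurableT_comp (measurable_rkernel b) (@measurable_chord2 R)).
Qed.

Lemma integral_indicE (D : set R) (G : R -> \bar R) :
  \int[mu]_(t in D) G t = \int[mu]_t ((\1_D t)%:E * G t).
Proof.
rewrite integral_mkcond; apply: eq_integral => t _; rewrite patchE indicE.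
by case: ifP => _; rewrite ?mul1e ?mul0e.
Qed.

Let h (J : set R) (z : R * R) : \bar R :=
  (\1_J z.1)%:E * ((\1_I01 z.2)%:E * (F z.2 * rkernel b (chord z.1 z.2))).

Let mh J : measurable J -> measurable_fun setT (h J).
Proof.
move=> mJ; apply: emeasurable_funM.
  apply/measurable_EFinP; apply: (measurableT_comp _ (@measurable_fst _ _ _ _)).
  exact: measurable_indic.
apply: emeasurable_funM; last exact: measurable_integrand2.
apply/measurable_EFinP; apply: (measurableT_comp _ (@measurable_snd _ _ _ _)).
by apply: measurable_indic; exact: measurable_itv.
Qed.

Let h0 J z : 0 <= h J z.
Proof. by rewrite /h !mule_ge0 ?lee_fin ?indicE ?rkernel_ge0// ler0n. Qed.

Lemma measurable_circle_potential : measurable_fun setT circle_potential.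
Proof.
rewrite [X in measurable_fun _ X](_ : _ = (fun s => \int[mu]_t h setT (s, t))).
  exact: (@measurable_fun_fubini_tonelli_F _ _ (measurableTypeR R) (measurableTypeR R) R
    (@lebesgue_measure R) _ (mh measurableT) (h0 _)).
apply/funext => s; rewrite /circle_potential integral_indicE.
by apply: eq_integral => t _; rewrite /h/= indicT mul1e.
Qed.

Lemma integral_circle_potential (J : set R) : measurable J ->
  \int[mu]_(s in J) circle_potential s =
  \int[mu]_(t in I01) (F t * \int[mu]_(s in J) rkernel b (chord s t)).
Proof.
move=> mJ.
transitivity (\int[mu]_s \int[mu]_t h J (s, t)).
  rewrite integral_indicE; apply: eq_integral => s _.
  rewrite /h/= ge0_integralZl//.
  - by congr (_ * _); rewrite /circle_potential integral_indicE.
  - apply: emeasurable_funM.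
      by apply/measurable_EFinP; apply: measurable_indic; exact: measurable_itv.
    apply: emeasurable_funM => //.
    under eq_fun do rewrite chordC.
    exact: measurable_rkernel_chord.
  - by move=> t _; rewrite !mule_ge0 ?lee_fin ?indicE ?rkernel_ge0.
have /= -> := @fubini_tonelli _ _ (measurableTypeR R) (measurableTypeR R) R
  (@lebesgue_measure R) (@lebesgue_measure R) (h J) (mh mJ) (h0 J).
rewrite [RHS]integral_indicE; apply: eq_integral => t _.
have mk : measurable_fun J (fun s => rkernel b (chord s t)).
  by apply: measurable_funTS; exact: measurable_rkernel_chord.
rewrite /h/= -!ge0_integralZl//.
- by rewrite [RHS]integral_indicE.
- exact: measurable_funeM.
- by move=> s _; rewrite mule_ge0// rkernel_ge0.
- by move=> s _; rewrite rkernel_ge0.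
Qed.

End tonelli.
End potential.

(** * Young inequality at the critical exponent *)

Section young.
Variable R : realType.

(* The hypothesis p <= 2 enters the argument through e^(1-p) <= 1/e. *)
Lemma powR_youngM (p X Y e : R) : 1 < p <= 2 -> 0 <= X -> 0 < Y -> 0 < e <= 1 ->
  X `^ p^-1 * Y `^ (1 - p^-1) <= e * Y + X / e.
Proof.
move=> /andP[p1 p2] X0 Y0 /andP[e0 e1].
have p0 : 0 < p by lra.
have pV0 : 0 < p^-1 by rewrite invr_gt0.
have pV1 : p^-1 <= 1 by rewrite invf_le1// ltW.
have ep : 0 < e `^ p by rewrite powR_gt0.
(* At this threshold [X^(1/p) = e Y^(1/p)]. Below it the product is at most [e * Y]; above it the
   product is at most [X * e^(1-p)]. *)
have [h|h] := leP X (e `^ p * Y).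
  apply: (@le_trans _ _ (e * Y)); last by rewrite lerDl divr_ge0// ltW.
  apply: (@le_trans _ _ ((e `^ p * Y) `^ p^-1 * Y `^ (1 - p^-1))).
    rewrite ler_wpM2r ?powR_ge0//; apply: ge0_ler_powR => //; first exact: ltW.
    by rewrite nnegrE mulr_ge0 ?ltW.
  rewrite powRM ?(ltW ep) ?(ltW Y0)// -powRrM mulfV ?gt_eqF// powRr1 ?(ltW e0)// -mulrA -powRD.
    by rewrite addrC subrK powRr1 ?(ltW Y0).
  by rewrite (gt_eqF Y0) implybT.
apply: (@le_trans _ _ (X / e)); last by rewrite lerDr mulr_ge0 ?ltW.
have XX : 0 < X by rewrite (lt_trans _ h)// mulr_gt0.
have h' : Y <= X * e `^ (- p).
  by rewrite powRN ler_pdivlMr// mulrC ltW.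
apply: (@le_trans _ _ (X `^ p^-1 * (X * e `^ (- p)) `^ (1 - p^-1))).
  rewrite ler_wpM2l ?powR_ge0//; apply: ge0_ler_powR => //; rewrite ?subr_ge0//.
  - by rewrite nnegrE ltW.
  - by rewrite nnegrE mulr_ge0 ?powR_ge0.
rewrite powRM ?powR_ge0// mulrA -powRD; last by rewrite (gt_eqF XX) implybT.
rewrite addrC subrK powRr1// ler_wpM2l// -powRrM.
have -> : - p * (1 - p^-1) = - (p - 1) by field; rewrite gt_eqF.
rewrite powRN lef_pV2 ?posrE ?powR_gt0//.
by apply: ger1_powR; [rewrite e0|lra].
Qed.

Lemma powRD_le (q x y : R) : 0 <= q <= 1 -> 0 <= x -> 0 <= y ->
  (x + y) `^ q <= 2 * (x `^ q + y `^ q).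
Proof.
move=> /andP[q0 q1] x0 y0.
wlog xy : x y x0 y0 / x <= y => [H|].
  have [|/ltW] := leP x y; first exact: H.
  by rewrite addrC [_ `^ q + _]addrC; exact: H.
apply: (@le_trans _ _ ((2 * y) `^ q)).
  by apply: ge0_ler_powR => //; rewrite ?nnegrE; lra.
rewrite powRM// ler_pM ?powR_ge0//.
  by apply: ler1_powR => //; lra.
by rewrite lerDr powR_ge0.
Qed.

Lemma exprV2_small (c : R) : 0 < c -> exists N, forall n, (N <= n)%N -> (2 ^+ n)^-1 <= c.
Proof.
move=> c0; have [|N HN] := @expr_unbounded R 2 c^-1; first lra.
by exists N => n /HN h; rewrite -[leRHS]invrK lef_pV2 ?posrE ?invr_gt0// exprn_gt0.
Qed.

End young.

(** * Averages of the potential over short intervals *)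

Section potential_estimates.
Variable R : realType.
Local Notation mu := (@lebesgue_measure R).
Local Notation I01 := (`[0%R, 1%R]%classic : set R).
Local Open Scope ereal_scope.
Variables (b : R) (F : R -> \bar R).
Hypothesis b0 : (0 <= b <= 1 / 2)%R.
Hypothesis mF : measurable_fun setT F.
Hypothesis F0 : forall t, 0 <= F t.
Local Notation u := (circle_potential b F).
Local Notation near x0 rho := (I01 `&` [set t : R | (chord t x0 <= rho)%R]).

Lemma measurable_near x0 (rho : R) : measurable (near x0 rho).
Proof.
by apply: measurableI; [exact: measurable_itv|exact: measurable_le_cst (measurable_chord x0)].
Qed.

Lemma measurable_kernel_mass (J : set R) : measurable J ->
  measurable_fun setT (fun t => \int[mu]_(s in J) rkernel b (chord s t)).
Proof.
move=> mJ.
pose h (z : R * R) := (\1_J z.1)%:E * rkernel b (chord z.1 z.2).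
rewrite [X in measurable_fun _ X](_ : _ = (fun t => \int[mu]_s h (s, t))); last first.
  by apply/funext => t; rewrite integral_indicE.
apply: (@measurable_fun_fubini_tonelli_G _ _ (measurableTypeR R) (measurableTypeR R) R
  (@lebesgue_measure R) h).
  apply: emeasurable_funM.
    apply/measurable_EFinP; apply: (measurableT_comp _ (@measurable_fst _ _ _ _)).
    exact: measurable_indic.
  exact: (measurableT_comp (measurable_rkernel b) (@measurable_chord2 R)).
by move=> z; rewrite /h mule_ge0 ?rkernel_ge0// lee_fin indicE ler0n.
Qed.

Lemma kernel_mass_ge0 (J : set R) t : 0 <= \int[mu]_(s in J) rkernel b (chord s t).
Proof. by apply: integral_ge0 => s _; exact: rkernel_ge0. Qed.

Lemma measurable_integrand x0 : measurable_fun setT (fun t => F t * rkernel b (chord x0 t)).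
Proof.
apply: emeasurable_funM => //; under eq_fun do rewrite chordC.
exact: measurable_rkernel_chord.
Qed.

(* The part of the potential coming from outside [near x0 (L * th)] is almost
   constant on the interval. *)
Lemma potential_split (L th x0 c r : R) : (8 < L)%R -> (0 < th)%R -> (0 < r)%R ->
  (forall s, (c <= s <= c + r)%R -> (`|s - x0| <= th)%R) ->
  \int[mu]_(s in `[c, (c + r)%R]) u s <=
  (r / (1 - 8 / L))%:E * u x0 +
  \int[mu]_(t in near x0 (L * th))
    (F t * \int[mu]_(s in `[c, (c + r)%R]) rkernel b (chord s t)).
Proof.
move=> L8 th0 r0 Jx; set J := `[c, (c + r)%R]%classic.
have mJ : measurable J by exact: measurable_itv.
have mI : measurable I01 by exact: measurable_itv.
rewrite integral_circle_potential//.
pose A t := \int[mu]_(s in J) rkernel b (chord s t).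
have mFA : measurable_fun setT (fun t => F t * A t).
  by apply: emeasurable_funM => //; exact: measurable_kernel_mass.
have FA0 t : 0 <= F t * A t by rewrite mule_ge0// kernel_mass_ge0.
have mk : measurable_fun I01 (fun t => F t * rkernel b (chord x0 t)).
  by apply: measurable_funTS; exact: measurable_integrand.
have k0 t : 0 <= F t * rkernel b (chord x0 t) by rewrite mule_ge0// rkernel_ge0.
have L1 : (0 < 1 - 8 / L)%R by rewrite subr_gt0 ltr_pdivrMr; lra.
have c0 : (0 <= r / (1 - 8 / L))%R by rewrite divr_ge0// ltW.
rewrite /circle_potential -ge0_integralZl// integral_mkcondr -ge0_integralD//; first last.
- apply: measurable_funTS; apply/measurable_restrict => //.
    exact: measurable_le_cst (measurable_chord x0).
  by rewrite setTI; exact: measurable_funTS.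
- by move=> t _; rewrite patchE; case: ifP.
- exact: measurable_funeM.
- by move=> t _; rewrite mule_ge0// lee_fin.
apply: ge0_le_integral => //.
- exact: measurable_funTS.
- apply: emeasurable_funD; first exact: measurable_funeM.
  apply: measurable_funTS; apply/measurable_restrict => //.
    exact: measurable_le_cst (measurable_chord x0).
  by rewrite setTI; exact: measurable_funTS.
move=> t It; rewrite patchE; case: ifPn => [_|].
  by rewrite leeDr// mule_ge0// lee_fin.
rewrite notin_setE /= => /negP; rewrite -ltNge => tn.
rewrite adde0 muleCA; apply: lee_wpmul2l => //.
apply: (@le_trans _ _ (\int[mu]_(s in J) cst (((1 - 8 / L)^-1)%:E * rkernel b (chord x0 t)) s)).
  apply: ge0_le_integral => //.
  - by move=> s _; exact: rkernel_ge0.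
  - by apply: measurable_funTS; exact: measurable_rkernel_chord.
  - move=> s; rewrite /J /= in_itv/= => /Jx sx.
    by apply: (rkernel_far b0 L8 th0 sx); rewrite chordC ltW.
rewrite integral_cst//= lebesgue_measure_itvcc; last lra.
have -> : (c + r - c = r)%R by lra.
by rewrite muleAC -EFinM mulrC.
Qed.

(** Monotone convergence. The set missing in the limit, [near x0 0], consists of parameters of one
    point of the circle and is null by [measure_chord_le] at radius 0. *)
Lemma integral_near_cvg (G : R -> \bar R) (x0 : R) : (0 <= x0 <= 1)%R ->
  measurable_fun setT G -> (forall t, 0 <= G t) ->
  \int[mu]_(t in I01 `\` near x0 (n.+1%:R^-1)%R) G t @[n --> \oo] -->
  \int[mu]_(t in I01) G t.
Proof.
move=> x01 mG G0.
have mI : measurable I01 by exact: measurable_itv.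
pose A (n : nat) : set R := I01 `\` near x0 (n.+1%:R^-1)%R.
have mA n : measurable (A n) by apply: measurableD => //; exact: measurable_near.
have ndA : nondecreasing_seq A.
  move=> n m nm; apply/subsetPset => t [It Nt]; split => // -[_ /= h]; apply: Nt; split => //=.
  by rewrite (le_trans h)// lef_pV2 ?posrE// ler_nat.
have UA : \bigcup_n A n = I01 `\` near x0 0%R.
  apply/seteqP; split => t.
    move=> [n _ [It Nt]]; split => // -[_ /= h]; apply: Nt; split => //=.
    by rewrite (le_trans h).
  move=> [It Nt].
  have ct : (0 < chord t x0)%R.
    by rewrite ltNge; apply/negP => h; apply: Nt.
  have [n hn] := ltr_add_invr ct; exists n => //; split => // -[_ /= h].
  by move: (lt_le_trans hn h); rewrite add0r ltxx.
have cv := @ge0_nondecreasing_set_cvg_integral _ (measurableTypeR R) R A G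
  (@lebesgue_measure R) ndA mA (fun=> measurable_funTS mG) (fun n t _ => G0 t).
have null0 : mu (near x0 0%R) = 0.
  apply/eqP; rewrite eq_le measure_ge0 andbT.
  by have := measure_chord_le x01 (lexx 0%R); rewrite mulr0.
have IE : \int[mu]_(t in I01) G t = \int[mu]_(t in I01 `\` near x0 0%R) G t.
  apply: ge0_negligible_integral => //; first exact: measurable_near.
  exact: measurable_funTS.
by rewrite UA -IE in cv.
Qed.

Lemma integral_near_small (G : R -> \bar R) (x0 d : R) : (0 <= x0 <= 1)%R ->
  measurable_fun setT G -> (forall t, 0 <= G t) ->
  \int[mu]_(t in I01) G t < +oo -> (0 < d)%R ->
  exists2 rho : R, (0 < rho)%R & \int[mu]_(t in near x0 rho) G t <= d%:E.
Proof.
move=> x01 mG G0 Gfin d0.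
have cv := integral_near_cvg x01 mG G0.
have mI : measurable I01 by exact: measurable_itv.
pose A (n : nat) : set R := I01 `\` near x0 (n.+1%:R^-1)%R.
have mA n : measurable (A n) by apply: measurableD => //; exact: measurable_near.
have Ifin : \int[mu]_(t in I01) G t \is a fin_num.
  by rewrite ge0_fin_numE// integral_ge0.
have [n hn] : exists n, \int[mu]_(t in I01) G t - d%:E < \int[mu]_(t in A n) G t.
  apply: contrapT => /forallNP H.
  have : \int[mu]_(t in I01) G t <= \int[mu]_(t in I01) G t - d%:E.
    rewrite -{1}(cvg_lim _ cv)//; apply: lime_le; first by apply/cvg_ex; exists (\int[mu]_(t in I01) G t).
    by apply: nearW => n; rewrite leNgt; apply/negP; exact: H.
  rewrite -(fineK Ifin) -EFinB lee_fin; lra.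
exists (n.+1%:R^-1)%R; first by rewrite invr_gt0.
have E : \int[mu]_(t in I01) G t = \int[mu]_(t in A n) G t + \int[mu]_(t in near x0 (n.+1%:R^-1)%R) G t.
  have sub : near x0 (n.+1%:R^-1)%R `<=` I01 by apply: subIsetl.
  rewrite addeC -ge0_integral_setU//.
  - by rewrite /A setDUK.
  - exact: measurable_near.
  - exact: mA.
  - exact: measurable_funTS.
  - by rewrite disj_set2E setDIK.
have Afin : \int[mu]_(t in A n) G t \is a fin_num.
  rewrite ge0_fin_numE ?integral_ge0//; apply: le_lt_trans Gfin.
  apply: ge0_subset_integral => //; [exact: mA|exact: measurable_funTS|].
  by move=> t [].
by move: hn; rewrite E lteBlDr// lteD2lE// => /ltW.
Qed.

Lemma far_constant (U0 t : R) : (0 <= U0 < t)%R ->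
  exists2 L : R, (8 < L)%R & (U0 / (1 - 8 / L) < t)%R.
Proof.
move=> /andP[U00 U0t]; have d0 : (0 < t - U0)%R by lra.
(* The goal amounts to [8 / L * t < t - U0]. The quotient alone would give equality; the summand 8
   makes it strict and ensures [L > 8]. *)
exists (8 * t / (t - U0) + 8)%R.
  by rewrite ltrDr divr_gt0//; lra.
set L := (_ + 8)%R.
have L0 : (0 < L)%R by rewrite /L addr_gt0// divr_gt0//; lra.
have LE : ((t - U0) * L = 8 * t + 8 * (t - U0))%R.
  by rewrite /L mulrDr mulrC divfK ?gt_eqF//; ring.
have L1 : (8 / L * t < t - U0)%R.
  by rewrite mulrAC ltr_pdivrMr// LE; lra.
have L2 : (8 / L < 1)%R.
  by rewrite -(@ltr_pM2r _ t) ?mul1r//; lra.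
by rewrite ltr_pdivrMr; lra.
Qed.

(** The interval starts at [x0], so the average of the kernel over it is at most [K] times the
    kernel at [x0], and the near part of the potential is a small piece of the finite integral
    [u x0]. Once the interval starts at a dyadic point instead, this comparison fails and Lebesgue
    points take over. *)
Lemma potential_avg_init (x0 t : R) : (0 < x0 < 1)%R -> u x0 < t%:E ->
  exists r : R, [/\ (0 < r)%R, (x0 + r <= 1)%R &
    \int[mu]_(s in `[x0, (x0 + r)%R]) u s < (t * r)%:E].
Proof.
move=> /andP[x00 x01] ut.
have b0' := b0.
have u0 : 0 <= u x0 by exact: circle_potential_ge0.
have ufin : u x0 \is a fin_num by rewrite ge0_fin_numE// (lt_trans ut)// ltry.
move: u0 ut; rewrite -(fineK ufin) lee_fin lte_fin; set U0 := fine _ => U00 U0t.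
have [L L8 LU] : exists2 L : R, (8 < L)%R & (U0 / (1 - 8 / L) < t)%R.
  by apply: far_constant; rewrite U00.
pose d := (t - U0 / (1 - 8 / L))%R.
have d0 : (0 < d)%R by rewrite subr_gt0.
(* 48 comes from [integral_rkernel_near], 8 from [chord_le]. *)
have [K K0 KE] : exists2 K : R, (0 < K)%R & (48 * 8 <= K)%R by exists (48 * 8)%R.
have x0I : (0 <= x0 <= 1)%R by lra.
have mG := measurable_integrand x0.
have G0 s : 0 <= F s * rkernel b (chord x0 s) by rewrite mule_ge0// rkernel_ge0.
have [rho rho0 hrho] : exists2 rho : R, (0 < rho)%R &
    \int[mu]_(s in near x0 rho) (F s * rkernel b (chord x0 s)) <= (d / (2 * K))%:E.
  apply: integral_near_small => //; last by rewrite divr_gt0// mulr_gt0.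
  by rewrite -/(u x0) -(fineK ufin) ltry.
(* [m] is the radius [L * r] of the near part: [x0 / 2] and [(1 - x0) / 2] rule out wrap-around, and
   1/4 keeps distances below 1/2, where the chord dominates the distance. *)
pose m : R := Num.min rho (Num.min (x0 / 2) (Num.min ((1 - x0) / 2) (1 / 4)))%R.
have m0 : (0 < m)%R by rewrite !lt_min rho0/=; apply/and3P; split; lra.
have [m1 m2 m3 m4] : [/\ (m <= rho)%R, (m <= x0 / 2)%R, (m <= (1 - x0) / 2)%R & (m <= 1 / 4)%R].
  by rewrite /m !ge_min !lexx !orbT.
have L0 : (0 < L)%R by lra.
pose r : R := (m / L)%R.
have r0 : (0 < r)%R by rewrite divr_gt0.
have Lr : (L * r = m)%R by rewrite mulrC divfK// gt_eqF.
have r8 : (r <= m / 8)%R.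
  by rewrite ler_pM2l// lef_pV2 ?posrE// ltW.
exists r; split => //; first lra.
have Jx (s : R) : (x0 <= s <= x0 + r)%R -> (`|s - x0| <= r)%R.
  by move=> h; rewrite ler_distl; lra.
apply: (le_lt_trans (potential_split L8 r0 r0 Jx)).
rewrite -(fineK ufin) -/U0 -EFinM Lr.
apply: (@le_lt_trans _ _ ((r / (1 - 8 / L) * U0)%:E + (K * r * (d / (2 * K)))%:E)); last first.
  rewrite -EFinD lte_fin.
  have -> : (r / (1 - 8 / L) * U0 = r * (U0 / (1 - 8 / L)))%R by ring.
  have -> : (U0 / (1 - 8 / L) = t - d)%R by rewrite /d; ring.
  have -> : (K * r * (d / (2 * K)) = r * d / 2)%R by field; rewrite gt_eqF.
  have := mulr_gt0 r0 d0; lra.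
have Kr : (0 <= K * r)%R by rewrite mulr_ge0 ?ltW.
apply: leeD => //.
apply: (@le_trans _ _ (\int[mu]_(s in near x0 m) ((K * r)%:E * (F s * rkernel b (chord x0 s))))).
  apply: ge0_le_integral => //.
  - exact: measurable_near.
  - by move=> s _; rewrite mule_ge0// kernel_mass_ge0.
  - apply: measurable_funTS; apply: emeasurable_funM => //; exact: measurable_kernel_mass.
  - by apply: measurable_funTS; exact: measurable_funeM.
  - move=> s [/=]; rewrite in_itv/= => s01 sm.
    have sx : (`|s - x0| <= m)%R by apply: near_dist => //; lra.
    rewrite muleCA; apply: lee_wpmul2l => //.
    have h1 : (r + `|s - x0| <= 1 / 2)%R by lra.
    apply: (le_trans (integral_rkernel_near b0 r0 (ltW x00) _ s01 h1)); first lra.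
    set M := Num.max _ _; have M0 : (0 < M)%R by rewrite lt_max r0 orbT.
    have h2 : (8^-1 * M `^ (- b))%:E <= rkernel b (chord x0 s).
      apply: (@le_trans _ _ (rkernel b (8 * M))).
        rewrite rkernelE ?mulr_gt0// lee_fin powRM ?(ltW M0)// ler_wpM2r ?powR_ge0//.
        rewrite powRN lef_pV2 ?posrE ?powR_gt0//.
        by apply: ler1_powR; lra.
      apply: rkernel_le; first lra.
      rewrite chord_ge0/= chordC (le_trans (chord_le _ _))// ler_pM2l//.
      by rewrite le_max lexx.
    apply: (@le_trans _ _ ((K * r)%:E * (8^-1 * M `^ (- b))%:E)); last first.
      by apply: lee_wpmul2l; rewrite ?lee_fin.
    rewrite -EFinM lee_fin.
    have h3 : (0 <= r * M `^ (- b))%R by rewrite mulr_ge0 ?powR_ge0 ?(ltW r0).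
    have := ler_wpM2r h3 KE; lra.
rewrite ge0_integralZl//; first last.
- exact: measurable_funTS.
- exact: measurable_near.
rewrite [leRHS]EFinM; apply: lee_wpmul2l; first by rewrite lee_fin.
apply: le_trans hrho; apply: ge0_subset_integral => //.
- exact: measurable_near.
- exact: measurable_near.
- exact: measurable_funTS.
- by move=> s [Is /= sm]; split => //=; exact: le_trans m1.
Qed.

(** Bookkeeping for the next proof: [w], [a], [z] stand for [g(x0)^(1/p)], [X^(1/p)], [M^(-b)] with
    [X = |g(t) - g(x0)|], and [y], [k], [q] for [1 / M], the dyadic kernel and [X / e]. *)
Lemma young_weighted_sum (w a z e y k q : R) : (a * z <= e * y + q)%R ->
  (e * y <= e * (2 * k))%R ->
  (2 * (w + a) * z <= 2 * w * z + 4 * e * k + 2 * q)%R.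
Proof. lra. Qed.

(* With M = max |t - c| r, write F = g^(1/p) <= 2 (g(x0)^(1/p) + |g - g(x0)|^(1/p))
   and split |g - g(x0)|^(1/p) M^(-b) <= e / M + |g - g(x0)| / e with e = eta * th.
   The first term integrates to e J, which is of order eta because
   J ~ log (1 / r) <= 2 / th, and the second one is small at a Lebesgue point. *)
Lemma near_integral_le (p x0 c r th L eta eps : R) (J : nat) (g : R -> R) :
  (1 < p <= 2)%R -> b = (1 - p^-1)%R ->
  r = (2 ^+ J.+1)^-1%R -> (J.+1%:R <= 2 / th)%R -> (`|x0 - c| <= th)%R ->
  (0 <= c)%R -> (c + r <= 1)%R -> (0 < L)%R -> (0 < th)%R ->
  (L * th < x0)%R -> (L * th < 1 - x0)%R -> (r + (L + 1) * th <= 1 / 2)%R ->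
  (0 < eta)%R -> (eta * th <= 1)%R ->
  measurable_fun setT g -> (forall t, (0 <= g t)%R) ->
  {ae mu, forall t, I01 t -> F t = (g t `^ p^-1)%:E} ->
  \int[mu]_(y in ball x0 (2 * L * th)%R) `|(g y - g x0)%:E| <= (eps * (4 * L * th))%:E ->
  \int[mu]_(t in near x0 (L * th)) (F t * \int[mu]_(s in `[c, (c + r)%R]) rkernel b (chord s t))
  <= (48 * r * (16 * g x0 `^ p^-1 * ((L + 1) * th) `^ (1 - b) + 16 * eta + 8 * L * eps / eta))%:E.
Proof.
move=> p12 bE rE Jth x0c c0 cr L0 th0 Lx0 Lx1 rL eta0 eth mg g0 Fg davg_le.
have r0 : (0 < r)%R by rewrite rE invr_gt0 exprn_gt0.
have e0 : (0 < eta * th)%R by rewrite mulr_gt0.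
pose v := (g x0 `^ p^-1)%R.
have v0 : (0 <= v)%R by exact: powR_ge0.
have pV : (0 <= p^-1 <= 1)%R.
  by rewrite invr_ge0 invf_le1; lra.
pose N := near x0 (L * th).
have mN : measurable N by exact: measurable_near.
(* [H1] carries the value of [g] at [x0], [H2] the term [e / M] of the Young inequality, [H3] the
   oscillation of [g]. *)
pose H1 (t : R) : \bar R := (2 * v)%:E * rkernel b `|t - c|%R.
pose H2 (t : R) : \bar R := (4 * (eta * th))%:E * (dyadic_kernel J.+1 `|t - c|)%:E.
pose H3 (t : R) : \bar R := (2 / (eta * th))%:E * `|(g t - g x0)%:E|.
have mk1 : measurable_fun N (fun t : R => rkernel b `|t - c|%R).
  by apply: measurable_funTS; exact: measurable_rkernel_dist.
have mk2 : measurable_fun N (fun t : R => (dyadic_kernel J.+1 `|t - c|)%:E).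
  apply/measurable_EFinP; apply: measurable_funTS.
  apply: (measurableT_comp (f := dyadic_kernel J.+1)); first exact: measurable_dyadic_kernel.
  exact: measurable_dist.
have mk3' : measurable_fun setT (fun t : R => `|(g t - g x0)%:E|).
  by apply: measurableT_comp => //; apply/measurable_EFinP; exact: measurable_funB.
have mk3 : measurable_fun N (fun t : R => `|(g t - g x0)%:E|) by exact: measurable_funTS.
have k1 : (0 <= 2 * v)%R by rewrite mulr_ge0.
have k2 : (0 <= 4 * (eta * th))%R by rewrite mulr_ge0// ltW.
have k3 : (0 <= 2 / (eta * th))%R by rewrite divr_ge0// ltW.
have H10 t : 0 <= H1 t by rewrite mule_ge0 ?lee_fin ?rkernel_ge0.
have H20 t : 0 <= H2 t by rewrite mule_ge0 ?lee_fin ?dyadic_kernel_ge0.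
have H30 t : 0 <= H3 t by rewrite mule_ge0 ?lee_fin// abse_ge0.
have mH1 : measurable_fun N H1 by exact: measurable_funeM.
have mH2 : measurable_fun N H2 by exact: measurable_funeM.
have mH3 : measurable_fun N H3 by exact: measurable_funeM.
have Nx0 t : N t -> (`|t - x0| <= L * th)%R.
  by move=> [/=]; rewrite in_itv/= => t01 tx; apply: near_dist.
have Nc t : N t -> (`|t - c| <= (L + 1) * th)%R.
  by move=> /Nx0 h; have := ler_distD x0 t c; lra.
have r48 : (0 <= 48 * r)%R by rewrite mulr_ge0// ltW.
apply: (@le_trans _ _ (\int[mu]_(t in N) ((48 * r)%:E * (H1 t + H2 t + H3 t)))).
  apply: ae_ge0_le_integral => //.
  - by move=> t _; rewrite mule_ge0// kernel_mass_ge0.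
  - apply: measurable_funTS; apply: emeasurable_funM => //; exact: measurable_kernel_mass.
  - by move=> t _; rewrite mule_ge0// ?lee_fin// !adde_ge0.
  - by apply: measurable_funeM; apply: emeasurable_funD => //; exact: emeasurable_funD.
  - have [Z [mZ Z0 subZ]] := Fg.
    exists Z; split => // t /= nH; apply: subZ => /= Fgt; apply: nH => Nt.
    have It := Nt.1; rewrite (Fgt It).
    have t01 : (0 <= t <= 1)%R by move: It; rewrite /= in_itv/=.
    have h1 : (r + `|t - c| <= 1 / 2)%R by have := Nc _ Nt; lra.
    apply: (@le_trans _ _ ((g t `^ p^-1)%:E * (48 * r * (Num.max `|t - c| r) `^ (- b))%:E)).
      by apply: lee_wpmul2l; [rewrite lee_fin powR_ge0|exact: integral_rkernel_near].
    set M := Num.max _ _; have M0 : (0 < M)%R by rewrite lt_max r0 orbT.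
    rewrite -EFinM mulrCA EFinM; apply: lee_wpmul2l; first by rewrite lee_fin.
    pose X := `|g t - g x0|%R.
    have gX : (g t `^ p^-1 <= 2 * (v + X `^ p^-1))%R.
      apply: le_trans (powRD_le pV (g0 x0) (normr_ge0 _)).
      apply: ge0_ler_powR; rewrite ?nnegrE ?addr_ge0//; first by case/andP: pV.
      by have := ler_norm (g t - g x0); rewrite -/X; lra.
    have Mb : (M `^ (- b) = (M^-1) `^ (1 - p^-1))%R.
      by rewrite -bE -[(M^-1)%R]powR_inv1 ?(ltW M0)// -powRrM mulN1r.
    have MV0 : (0 < M^-1)%R by rewrite invr_gt0.
    have young := @powR_youngM R p X (M^-1) (eta * th) p12 (normr_ge0 _) MV0 _.
    have {}young : (X `^ p^-1 * M `^ (- b) <= (eta * th) * M^-1 + X / (eta * th))%R.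
      by rewrite Mb; apply: young; rewrite e0.
    have MU : (M^-1 <= 2 * dyadic_kernel J.+1 `|t - c|)%R.
      have t1 : (`|t - c| <= 1)%R by lra.
      have := dyadic_kernel_max_ge J t1; rewrite -rE -/M mulrA => h.
      by rewrite -[leLHS]mul1r ler_pdivrMr.
    apply: (@le_trans _ _ (((2 * v) * M `^ (- b))%:E + H2 t + H3 t)); last first.
      apply: leeD => //; apply: leeD => //.
      rewrite /H1 EFinM; apply: lee_wpmul2l; first by rewrite lee_fin.
      rewrite -rkernelE//; apply: rkernel_le; first by have := b0; lra.
      by rewrite normr_ge0/= le_max lexx.
    rewrite /H2 /H3 abse_EFin -!EFinM -!EFinD lee_fin -/X.
    have Mb0 : (0 <= M `^ (- b))%R by exact: powR_ge0.
    apply: (@le_trans _ _ (2 * (v + X `^ p^-1) * M `^ (- b)))%R; first by rewrite ler_wpM2r.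
    have h2 : ((eta * th) * M^-1 <= (eta * th) * (2 * dyadic_kernel J.+1 `|t - c|))%R.
      by rewrite ler_pM2l.
    have -> : (2 / (eta * th) * X = 2 * (X / (eta * th)))%R by ring.
    exact: (young_weighted_sum _ young h2).
rewrite ge0_integralZl//; last first.
- by move=> t _; rewrite !adde_ge0.
- by apply: emeasurable_funD => //; exact: emeasurable_funD.
rewrite [leRHS]EFinM; apply: lee_wpmul2l; first by rewrite lee_fin.
rewrite ge0_integralD//; first last.
- exact: emeasurable_funD.
- by move=> t _; rewrite adde_ge0.
rewrite ge0_integralD// /H1 /H2 /H3 !ge0_integralZl//; first last.
- by move=> t _; rewrite rkernel_ge0.
- by move=> t _; rewrite lee_fin dyadic_kernel_ge0.
have L10 : (0 < (L + 1) * th)%R by rewrite mulr_gt0//; lra.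
rewrite !EFinD; apply: leeD; first apply: leeD.
- apply: (@le_trans _ _ ((2 * v)%:E * (8 * ((L + 1) * th) `^ (1 - b))%:E)); last first.
    by rewrite -EFinM lee_fin /v; lra.
  apply: lee_wpmul2l; first by rewrite lee_fin.
  apply: le_trans (integral_rkernel_le c b0 L10); apply: ge0_subset_integral => //.
  + exact: measurable_le_cst (measurable_dist c).
  + by apply: measurable_funTS; exact: measurable_rkernel_dist.
  + by move=> t _; exact: rkernel_ge0.
- apply: (@le_trans _ _ ((4 * (eta * th))%:E * (2 * J.+1%:R)%:E)).
    apply: lee_wpmul2l; first by rewrite lee_fin.
    rewrite integral_dyadic_kernel//; last exact: measurable_dist.
    have -> : (2 * J.+1%:R)%:E = \sum_(j < J.+1) (2%:E : \bar R).
      by rewrite sumEFin sumr_const card_ord mulr_natr.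
    apply: lee_sum => j _.
    apply: (@le_trans _ _ ((2 ^+ j)%:E * (2 * (2 ^+ j)^-1)%:E)).
      apply: lee_wpmul2l; first by rewrite lee_fin exprn_ge0.
      by apply: measure_dist_le => //; exact: ltW (pow2V_gt0 _ _).
    by rewrite -EFinM lee_fin mulrCA divff ?mulr1// gt_eqF// pow2_gt0.
  rewrite -EFinM lee_fin.
  have : (th * J.+1%:R <= 2)%R by rewrite mulrC -ler_pdivlMr.
  move: (J.+1%:R)%R => z hz.
  have := ler_wpM2l (ltW eta0) hz; lra.
- apply: (@le_trans _ _ ((2 / (eta * th))%:E * (eps * (4 * L * th))%:E)); last first.
    rewrite -EFinM lee_fin le_eqVlt; apply/orP; left; apply/eqP; field.
    by rewrite !gt_eqF.
  apply: lee_wpmul2l; first by rewrite lee_fin.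
  apply: le_trans davg_le; apply: ge0_subset_integral => //.
  + exact: measurable_ball.
  + exact: measurable_funTS.
  + move=> t /Nx0 h; rewrite /ball/= distrC (le_lt_trans h)//.
    by have := mulr_gt0 L0 th0; lra.
Qed.

Lemma lebesgue_pt_small (g : R -> R) (x0 eps : R) : lebesgue_pt g x0 -> (0 < eps)%R ->
  exists2 rho0 : R, (0 < rho0)%R & forall rho : R, (0 < rho < rho0)%R ->
  \int[mu]_(y in ball x0 rho) `|(g y - g x0)%:E| <= (eps * (rho * 2))%:E.
Proof.
move=> gx e0.
have /gx : nbhs (0%R : R)%:E [set y : \bar R | y < eps%:E].
  exact: (@nbhs_open_ereal_lt R 0%R (fun=> eps)).
move=> [rho0 /= rho00 H]; exists rho0 => // rho /andP[rho1 rho2].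
have : davg g x0 rho < eps%:E.
  by apply: H => //=; rewrite sub0r normrN gtr0_norm.
rewrite /davg /iavg lebesgue_measure_ball ?(ltW rho1)// inver.
have r2 : (0 < rho *+ 2)%R by rewrite mulrn_wgt0.
rewrite gt_eqF// muleC lte_pdivrMr// => /ltW.
by rewrite -EFinM mulr_natr.
Qed.

(** The far part costs the factor [1 / (1 - 8 / L)] and the near part is an error. The order of
    choice is [L], [eta], [eps], and only then the level [n], so that both fit below [t]. *)
Lemma potential_avg_step (p x0 t : R) (g : R -> R) :
  (1 < p <= 2)%R -> b = (1 - p^-1)%R ->
  measurable_fun setT g -> (forall t, (0 <= g t)%R) ->
  {ae mu, forall t, I01 t -> F t = (g t `^ p^-1)%:E} ->
  lebesgue_pt g x0 -> (0 < x0 < 1)%R -> u x0 < t%:E ->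
  exists N, forall n (c : R), (N <= n)%N -> (0 <= c)%R -> (c <= x0 <= c + (2 ^+ n)^-1)%R ->
    (c + (2 ^+ (n + 2 ^ n))^-1 <= 1)%R ->
    \int[mu]_(s in `[c, (c + (2 ^+ (n + 2 ^ n))^-1)%R]) u s <
      (t * (2 ^+ (n + 2 ^ n))^-1)%:E.
Proof.
move=> p12 bE mg g0 Fg gx /andP[x00 x01] ut.
have b0' := b0.
have u0 : 0 <= u x0 by exact: circle_potential_ge0.
have ufin : u x0 \is a fin_num by rewrite ge0_fin_numE// (lt_trans ut)// ltry.
move: u0 ut; rewrite -(fineK ufin) lee_fin lte_fin; set U0 := fine _ => U00 U0t.
have [L L8 LU] : exists2 L : R, (8 < L)%R & (U0 / (1 - 8 / L) < t)%R.
  by apply: far_constant; rewrite U00.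
pose d := (t - U0 / (1 - 8 / L))%R.
have d0 : (0 < d)%R by rewrite subr_gt0.
have L0 : (0 < L)%R by lra.
(* Each of the three errors of [near_integral_le] is to stay below [d / 4], so that their sum is
   less than [d]. *)
have [dK dK0 dKd] : exists2 dK : R, (0 < dK)%R & (48 * (16 * dK) <= d / 4)%R.
  exists (d / (48 * (16 * 4)))%R; first by rewrite divr_gt0.
  lra.
pose v := (g x0 `^ p^-1)%R.
have v0 : (0 <= v)%R by exact: powR_ge0.
pose eta : R := Num.min 1%R dK.
have eta0 : (0 < eta)%R by rewrite lt_min ltr01.
have [eta1 etad] : (eta <= 1)%R /\ (eta <= dK)%R by rewrite /eta !ge_min !lexx orbT.
(* The oscillation error is divided by [eta], already fixed; this choice turns [8 * L * eps / eta]
   into [8 * dK]. *)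
pose eps : R := (eta * dK / L)%R.
have eps0 : (0 < eps)%R by rewrite divr_gt0// mulr_gt0.
have [rho0 rho00 hrho] := lebesgue_pt_small gx eps0.
(* [v + 1] is positive even if [g x0 = 0]; [k1] undoes the power [1 - b], so that a small [th]
   bounds [((L + 1) * th)^(1 - b)] by [k0]. *)
pose k0 : R := (dK / (v + 1))%R.
have k00 : (0 < k0)%R by rewrite divr_gt0//; lra.
pose k1 : R := (k0 `^ (1 - b)^-1)%R.
have k10 : (0 < k1)%R by rewrite powR_gt0.
pose m : R := (Num.min (rho0 / 4) (Num.min (x0 / 2) (Num.min ((1 - x0) / 2) (Num.min k1 (1 / 8)))))%R.
have m0 : (0 < m)%R by rewrite !lt_min k10/=; apply/and4P; split; lra.
have [m1 m2 m3 m4 m5] : [/\ (m <= rho0 / 4)%R, (m <= x0 / 2)%R, (m <= (1 - x0) / 2)%R, (m <= k1)%R & (m <= 1 / 8)%R].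
  by rewrite /m !ge_min !lexx !orbT.
have mL0 : (0 < m / (L + 1))%R by rewrite divr_gt0//; lra.
have [N HN] := exprV2_small mL0.
exists N => n c Nn c0 cx; set r : R := ((2 ^+ (n + 2 ^ n))^-1)%R => cr.
have := HN n Nn; set th : R := ((2 ^+ n)^-1)%R => thm.
have th0 : (0 < th)%R by exact: pow2V_gt0.
have r0 : (0 < r)%R by exact: pow2V_gt0.
rewrite -/th in cx.
have rth : (r <= th)%R.
  by rewrite lef_pV2 ?posrE ?pow2_gt0// ler_eXn2l ?ltr1n// leq_addr.
have Lm : ((L + 1) * th <= m)%R by rewrite mulrC -ler_pdivlMr//; lra.
have thm8 : (th <= m / 9)%R.
  have : (9 * th <= (L + 1) * th)%R by rewrite ler_pM2r//; lra.
  lra.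
have Lth : (0 < L * th)%R by rewrite mulr_gt0.
have Jx (s : R) : (c <= s <= c + r)%R -> (`|s - x0| <= th)%R.
  by move=> h; rewrite ler_distl; lra.
apply: (le_lt_trans (potential_split L8 th0 r0 Jx)).
rewrite -(fineK ufin) -/U0 -EFinM.
have Jn : exists J, (n + 2 ^ n)%N = J.+1.
  by exists (n + 2 ^ n).-1; rewrite prednK// addn_gt0 expn_gt0 orbT.
have [J JE] := Jn.
have near_le := @near_integral_le p x0 c r th L eta eps J g p12 bE.
have {}near_le := leeD (lexx (r / (1 - 8 / L) * U0)%:E) (near_le _ _ _ c0 cr L0 th0 _ _ _ eta0 _ mg g0 Fg _).
apply: (le_lt_trans (near_le _ _ _ _ _ _ _ _)) => {near_le}.
- by rewrite /r JE.
(* The number of scales is [n + 2^n <= 2 * 2^n = 2 / th]. *)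
- rewrite -JE natrD /th invrK.
  have : (n%:R <= 2 ^+ n :> R)%R by rewrite -natrX ler_nat ltnW// ltn_expl.
  by rewrite natrX; lra.
- by rewrite ler_distl; lra.
- lra.
- lra.
- lra.
- have := ler_pM (ltW eta0) (ltW th0) eta1 (_ : th <= 1)%R; rewrite mul1r; apply; lra.
- have h : (0 < 2 * L * th < rho0)%R by rewrite -mulrA; lra.
  apply: (le_trans (hrho _ h)); rewrite lee_fin; lra.
rewrite -EFinD lte_fin -/v.
have b1 : (0 < 1 - b)%R by lra.
have y0 : (0 <= ((L + 1) * th) `^ (1 - b) <= k0)%R.
  rewrite powR_ge0/=.
  have -> : (k0 = k1 `^ (1 - b))%R by rewrite /k1 -powRrM mulVf ?gt_eqF// powRr1// ltW.
  apply: ge0_ler_powR; rewrite ?nnegrE ?(ltW b1) ?(ltW k10)//; last lra.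
  by rewrite mulr_ge0 ?(ltW th0)//; lra.
have h1 : (48 * (16 * v * ((L + 1) * th) `^ (1 - b)) <= d / 4)%R.
  have : (v * ((L + 1) * th) `^ (1 - b) <= (v + 1) * k0)%R.
    by apply: ler_pM => //; case/andP: y0 => //; lra.
  have -> : ((v + 1) * k0 = dK)%R by rewrite /k0 mulrC divfK// gt_eqF//; lra.
  lra.
have h3 : (48 * (8 * L * eps / eta) <= d / 4)%R.
  have -> : (8 * L * eps / eta = 8 * dK)%R by rewrite /eps; field; rewrite !gt_eqF.
  lra.
have -> : (r / (1 - 8 / L) * U0 = r * (U0 / (1 - 8 / L)))%R by ring.
have -> : (U0 / (1 - 8 / L) = t - d)%R by rewrite /d; ring.
set A := (16 * v * _)%R in h1 *; set B := (8 * L * _ / _)%R in h3 *.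
have -> : (48 * r * (A + 16 * eta + B) = r * (48 * A + 48 * (16 * eta) + 48 * B))%R by ring.
rewrite -mulrDr mulrC ltr_pM2r//; lra.
Qed.

End potential_estimates.

(** * The case p <= 2 *)

Section circle_param.
Variable R : realType.

Lemma circle_expi (z : R * R) : circle R z -> exists2 x : R, 0 <= x <= 1 & expi x = z.
Proof.
case: z => z1 z2; rewrite /circle /eucl_dist /= !subr0 => h.
have h1 : z1 ^+ 2 + z2 ^+ 2 = 1.
  by rewrite -[LHS]sqr_sqrtr ?h ?expr1n// addr_ge0 ?sqr_ge0.
have z11 : -1 <= z1 <= 1.
  rewrite -ler_norml -(@expr_le1 _ 2 `|z1|)// real_normK ?num_real//.
  by have := sqr_ge0 z2; lra.
have pi0 := @pi_gt0 R.
pose th := acos z1.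
have th0 : 0 <= th by exact: acos_ge0.
have thpi : th <= pi by exact: acos_lepi.
have cth : cos th = z1 by rewrite acosK// in_itv.
have sth : sin th = `|z2|.
  by rewrite sin_acos// -sqrtr_sqr; congr Num.sqrt; lra.
have e2 : 2 * pi = pi *+ 2 :> R by rewrite mulr_natl.
have eth : 2 * pi * (th / (2 * pi)) = th by rewrite mulrC divfK// gt_eqF// mulr_gt0.
have [z20|z20] := leP 0 z2.
  exists (th / (2 * pi)).
    apply/andP; split; first by rewrite divr_ge0// mulr_ge0// ltW.
    by rewrite ler_pdivrMr ?mulr_gt0//; lra.
  by rewrite /expi eth cth sth ger0_norm.
exists (1 - th / (2 * pi)).
  have : 0 <= th / (2 * pi) <= 1.
    apply/andP; split; first by rewrite divr_ge0// mulr_ge0// ltW.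
    by rewrite ler_pdivrMr ?mulr_gt0//; lra.
  lra.
rewrite /expi mulrBr mulr1 eth e2 cosB sinB cos2pi sin2pi cth sth.
by rewrite !mul1r !mul0r addr0 sub0r ltr0_norm// opprK.
Qed.

End circle_param.

(** * The nested intervals and their limit point *)

Section limit.
Variable R : realType.
Local Notation mu := (@lebesgue_measure R).
Local Notation I01 := (`[0%R, 1%R]%classic : set R).
Local Open Scope ereal_scope.
Local Notation near x0 rho := (I01 `&` [set t : R | (chord t x0 <= rho)%R]).

Variables (p : R) (F : R -> \bar R).
Hypothesis p12 : (1 < p <= 2)%R.
Hypothesis mF : measurable_fun setT F.
Hypothesis F0 : forall t, 0 <= F t.
Local Notation b := (1 - p^-1)%R.
Local Notation u := (circle_potential b F).

Lemma half_exponent : (0 <= b <= 1 / 2)%R.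
Proof.
have /andP[p1 p2] := p12.
have h1 : (p^-1 <= 1)%R by rewrite invf_le1; lra.
have h2 : (2^-1 <= p^-1)%R by rewrite lef_pV2 ?posrE; lra.
lra.
Qed.

(* Points approximating x at distance much smaller than the radius of a removed
   neighbourhood see the rest of the potential almost as x does. *)
Lemma potential_limit (x t L : R) : (0 <= x <= 1)%R -> (8 < L)%R -> (0 <= t)%R ->
  (forall e : R, (0 < e)%R -> exists2 y : R, (`|x - y| <= e)%R & u y <= t%:E) ->
  u x <= (t / (1 - 8 / L))%:E.
Proof.
move=> x01 L8 t0 H.
have b0 := half_exponent.
have L0 : (0 < L)%R by lra.
have L1 : (0 < 1 - 8 / L)%R by rewrite subr_gt0 ltr_pdivrMr; lra.
have mI : measurable I01 by exact: measurable_itv.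
have mG := measurable_integrand b mF.
have G0 s : 0 <= F s * rkernel b (chord x s) by rewrite mule_ge0// rkernel_ge0.
have cv := integral_near_cvg x01 (mG x) G0.
rewrite /circle_potential -(cvg_lim _ cv)//; apply: lime_le.
  by apply/cvg_ex; eexists; exact: cv.
apply: nearW => n; pose d : R := (n.+1%:R^-1)%R.
have d0 : (0 < d)%R by rewrite invr_gt0.
have dL0 : (0 < d / (2 * L))%R by rewrite divr_gt0// mulr_gt0.
have [y xy uy] := H _ dL0.
have mA : measurable (I01 `\` near x d) by apply: measurableD => //; exact: measurable_near.
rewrite mulrC EFinM; apply: le_trans (lee_wpmul2l _ uy); last first.
  by rewrite lee_fin invr_ge0 ltW.
rewrite /circle_potential -ge0_integralZl//; first last.
- by rewrite lee_fin invr_ge0 ltW.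
- by move=> s _; rewrite mule_ge0// rkernel_ge0.
- by apply: measurable_funTS; exact: mG.
apply: (@le_trans _ _ (\int[mu]_(s in I01 `\` near x d)
   (((1 - 8 / L)^-1)%:E * (F s * rkernel b (chord y s))))); last first.
  apply: ge0_subset_integral => //.
  - by apply: measurable_funTS; apply: measurable_funeM; exact: mG.
  - by move=> s _; rewrite !mule_ge0 ?rkernel_ge0// lee_fin invr_ge0 ltW.
apply: ge0_le_integral => //.
- by apply: measurable_funTS; exact: mG.
- by apply: measurable_funTS; apply: measurable_funeM; exact: mG.
move=> s [Is Ns]; rewrite muleCA; apply: lee_wpmul2l => //.
apply: (rkernel_far b0 L8 dL0 xy).
have sd : (d < chord s x)%R by rewrite ltNge; apply/negP => h; apply: Ns.
have -> : (L * (d / (2 * L)) = d / 2)%R by field; rewrite gt_eqF.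
have h1 := chord_triangle y s x; have h2 := chord_le y x.
rewrite [chord s y]chordC in h1; rewrite distrC in h2.
have h3 : (8 * (d / (2 * L)) <= d / 2)%R.
  rewrite mulrCA ler_pM2l// invfM mulrCA -[leRHS]mulr1 ler_pM2l// ler_pdivrMr//; lra.
lra.
Qed.

Variable g : R -> R.
Hypothesis mg : measurable_fun setT g.
Hypothesis g0 : forall t, (0 <= g t)%R.
Hypothesis Fg : {ae mu, forall t, I01 t -> F t = (g t `^ p^-1)%:E}.
Hypothesis gL : {ae mu, forall t, lebesgue_pt g t}.

Variable t : R.
Hypothesis t0 : (0 <= t)%R.

(** The invariant of the nested construction. The threshold [t] is the same at all stages, so that
    no loss accumulates. *)
Definition low_average (a r : R) : Prop :=
  [/\ (0 <= a)%R, (0 < r)%R, (a + r <= 1)%R &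
    \int[mu]_(s in `[a, (a + r)%R]) u s < (t * r)%:E].

(** Otherwise [u >= t] almost everywhere on the interval, against the average. Taking the point in
    the open interval leaves room for a smaller interval near it. *)
Lemma low_average_point a r : low_average a r ->
  exists x : R, [/\ (a < x < a + r)%R, u x < t%:E & lebesgue_pt g x].
Proof.
move=> [a0 r0 ar]; apply: contraPP => /forallNP H; apply/negP; rewrite -leNgt.
have mu_ : measurable_fun setT u by exact: measurable_circle_potential.
apply: (@le_trans _ _ (\int[mu]_(s in `]a, (a + r)%R[) u s)); last first.
  apply: ge0_subset_integral => //.
  - exact: measurable_funTS.
  - by move=> s _; exact: circle_potential_ge0.
  - by move=> s /=; rewrite !in_itv/= => /andP[/ltW -> /ltW ->].
have -> : (t * r)%:E = \int[mu]_(s in `]a, (a + r)%R[) (cst t%:E s).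
  rewrite integral_cst//= lebesgue_measure_itv/= lte_fin ltrDl r0 -EFinB -EFinM.
  by congr (_%:E); ring.
apply: ae_ge0_le_integral => //.
- by move=> s _; exact: circle_potential_ge0.
- exact: measurable_funTS.
have [Z [mZ Z0 subZ]] := gL.
exists Z; split => // s /= nH; apply: subZ => /= gs; apply: nH.
rewrite in_itv/= => sI; rewrite leNgt; apply/negP => us.
by apply: (H s).
Qed.

Lemma low_average_refine a r N : low_average a r -> exists n m : nat,
  let a' := (m%:R / 2 ^+ n)%R in let r' := ((2 ^+ (n + 2 ^ n))^-1)%R in
  [/\ (N <= n)%N, low_average a' r', (a <= a')%R & (a' + r' <= a + r)%R].
Proof.
move=> lar; have [a0 r0 ar _] := lar.
have [x [/andP[ax xr] ux gx]] := low_average_point lar.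
have x01 : (0 < x < 1)%R by apply/andP; split; lra.
have [N1 HN1] := potential_avg_step half_exponent mF F0 p12 erefl mg g0 Fg gx x01 ux.
(* The dyadic point is less than [2^(-n)] below [x], and the new interval is no longer than
   [2^(-n)]; this margin keeps it inside the old one. *)
have e0 : (0 < Num.min (x - a) (a + r - x))%R by rewrite lt_min; apply/andP; split; lra.
have [N2 HN2] := exprV2_small e0.
pose n := maxn N (maxn N1 N2).
have nN : (N <= n)%N by rewrite leq_maxl.
have nN1 : (N1 <= n)%N by rewrite /n leq_max leq_maxl orbT.
have nN2 : (N2 <= n)%N by rewrite /n leq_max leq_maxr orbT.
have := HN2 n nN2; rewrite le_min => /andP[h1 h2].
have xn0 : (0 <= 2 ^+ n * x)%R by rewrite mulr_ge0 ?exprn_ge0//; lra.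
pose m := Num.truncn (2 ^+ n * x).
have /andP[m1 m2] := truncn_itv xn0.
exists n, m => a' r'.
have r'0 : (0 < r')%R by exact: pow2V_gt0.
have r'n : (r' <= (2 ^+ n)^-1)%R.
  by rewrite lef_pV2 ?posrE ?pow2_gt0// ler_eXn2l ?ltr1n// leq_addr.
have a'x : (a' <= x)%R by rewrite ler_pdivrMr ?pow2_gt0// mulrC.
have xa' : (x <= a' + (2 ^+ n)^-1)%R.
  by rewrite -[X in (_ + X)%R]mul1r -mulrDl ler_pdivlMr ?pow2_gt0// mulrC natr1 ltW.
have a'0 : (0 <= a')%R by rewrite divr_ge0// exprn_ge0.
have ar' : (a' + r' <= a + r)%R by lra.
split => //; last lra.
split => //; first lra.
by apply: HN1 => //; [rewrite a'x|exact: le_trans ar' ar].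
Qed.

(** The supremum of the left ends lies in all the intervals, so [dobinski_of_close] applies. Nothing
    bounds [u] at that point directly; what survives is that each interval contains a point with
    [u < t], the input of [potential_limit]. *)
Lemma low_average_dobinski a r : low_average a r ->
  exists2 x : R, dobinski R x & forall e : R, (0 < e)%R ->
    exists2 y : R, (`|x - y| <= e)%R & u y <= t%:E.
Proof.
move=> lar.
pose S := {s : R * R | low_average s.1 s.2}.
(* The counter forces level at least [k] at stage [k], so the levels tend to infinity. *)
pose Q (sN : S * nat) (s' : S) := exists n m : nat,
  [/\ (sN.2 <= n)%N, (sval s').1 = (m%:R / 2 ^+ n)%R,
      (sval s').2 = ((2 ^+ (n + 2 ^ n))^-1)%R,
      ((sval sN.1).1 <= (sval s').1)%R &
      ((sval s').1 + (sval s').2 <= (sval sN.1).1 + (sval sN.1).2)%R].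
have [nxt Hnxt] : {nxt : S * nat -> S & forall sN, Q sN (nxt sN)}.
  apply: (@choice _ _ Q) => -[[[a1 r1] /= l1] N].
  have [n [m [nN l2 aa ar]]] := low_average_refine N l1.
  by exists (exist _ (m%:R / 2 ^+ n, (2 ^+ (n + 2 ^ n))^-1)%R l2), n, m; split.
pose s0 : S := exist (fun s => low_average s.1 s.2) (a, r) lar.
pose st := fix st k := if k is k'.+1 then nxt (st k', k') else s0.
pose A k := (sval (st k)).1; pose B k := ((sval (st k)).1 + (sval (st k)).2)%R.
have Pk k : low_average (sval (st k)).1 (sval (st k)).2 by exact: (svalP (st k)).
have AB k : (A k <= B k)%R.
  by have [_ h _ _] := Pk k; rewrite /B lerDl ltW.
have ndA : nondecreasing_seq A.
  by apply/nondecreasing_seqP => k; have [n [m [_ _ _ h _]]] := Hnxt (st k, k).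
have niB : nonincreasing_seq B.
  by apply/nonincreasing_seqP => k; have [n [m [_ _ _ _ h]]] := Hnxt (st k, k).
have ABkl k l : (A k <= B l)%R.
  apply: (@le_trans _ _ (A (maxn k l))); first by apply: ndA; exact: leq_maxl.
  by apply: (le_trans (AB _)); apply: niB; exact: leq_maxr.
pose x := sup (range A).
have hs : has_sup (range A).
  split; first by exists (A 0%N), 0%N.
  by exists (B 0%N) => _ [k _ <-].
have xA k : (A k <= x)%R by apply: ub_le_sup; [case: hs|exists k].
have xB k : (x <= B k)%R by apply: ge_sup; [case: hs|move=> _ [l _ <-]].
have small k : exists n m : nat, [/\ (k <= n)%N, A k.+1 = (m%:R / 2 ^+ n)%R &
    B k.+1 = (m%:R / 2 ^+ n + (2 ^+ (n + 2 ^ n))^-1)%R].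
  have [n [m [kn e1 e2 _ _]]] := Hnxt (st k, k); exists n, m; split => //.
  by rewrite /B /= e1 e2.
exists x.
  apply: dobinski_of_close.
    apply/andP; split; first by apply: le_trans (xA 0%N); have [] := Pk 0%N.
    by apply: (le_trans (xB 0%N)); have [] := Pk 0%N.
  move=> N; have [n [m [Nn e1 e2]]] := small N.
  by exists n, m; split => //; rewrite -e2 -e1 xA xB.
move=> e e0; have [k0 Hk0] := exprV2_small e0.
have [n [m [kn e1 e2]]] := small k0.
have [y [/andP[y1 y2] uy _]] := low_average_point (Pk k0.+1).
exists y; last exact: ltW.
apply: (@le_trans _ _ (2 ^+ n)^-1)%R; last exact: Hk0.
have h : ((2 ^+ (n + 2 ^ n))^-1 <= (2 ^+ n)^-1 :> R)%R.
  by rewrite lef_pV2 ?posrE ?pow2_gt0// ler_eXn2l ?ltr1n// leq_addr.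
have := xA k0.+1; have := xB k0.+1; rewrite -/(A k0.+1) -/(B k0.+1) in y1 y2.
by rewrite e1 e2 in y1 y2 * => h1 h2; rewrite ler_norml; apply/andP; split; lra.
Qed.

End limit.

(** * From the Dobinski set to the whole circle *)

Section full_capacity.
Variable R : realType.
Local Notation mu := (@lebesgue_measure R).
Local Notation I01 := (`[0%R, 1%R]%classic : set R).
Local Open Scope ereal_scope.

(** This settles the endpoints, so that the interval construction starts at an interior point. *)
Lemma dobinski01 (x : R) : x = 0%R \/ x = 1%R -> dobinski R x.
Proof.
move=> x01; apply: dobinski_of_close; first by case: x01 => ->; lra.
move=> N; exists N; case: x01 => ->.
  exists 0%N; split => //; rewrite mul0r lexx add0r; exact: ltW (pow2V_gt0 _ _).
exists (2 ^ N)%N; split => //; rewrite natrX divff ?gt_eqF ?pow2_gt0// lexx lerDl.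
exact: ltW (pow2V_gt0 _ _).
Qed.

(** Finite energy makes [F^p] finite almost everywhere, so [fine] changes it only on a null set; the
    cut-off to [0, 1] makes it integrable on the line, for Lebesgue differentiation. *)
Lemma root_density (p : R) (F : R -> \bar R) : (1 < p)%R -> measurable_fun setT F ->
  (forall t, 0 <= F t) -> \int[mu]_(t in I01) (F t `^ p) < +oo ->
  exists g : R -> R, [/\ measurable_fun setT g, forall t, (0 <= g t)%R,
    {ae mu, forall t, I01 t -> F t = (g t `^ p^-1)%:E} &
    {ae mu, forall t, lebesgue_pt g t}].
Proof.
move=> p1 mF F0 Ffin.
have p0 : (0 < p)%R by lra.
have mI : measurable I01 by exact: measurable_itv.
have mFp : measurable_fun setT (fun t => F t `^ p) by exact: (measurableT_comp (measurable_poweR p) mF).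
have mfine : measurable_fun setT (fun t => fine (F t `^ p)).
  exact: (measurableT_comp (fine_measurable measurableT) mFp).
pose g t : R := (\1_I01 t * fine (F t `^ p))%R.
have mg : measurable_fun setT g.
  by apply: measurable_funM => //; exact: measurable_indic.
have g0 t : (0 <= g t)%R by rewrite mulr_ge0 ?fine_ge0 ?poweR_ge0// indicE ler0n.
exists g; split => //.
- have iF : mu.-integrable I01 (fun t => F t `^ p).
    apply/integrableP; split; first exact: measurable_funTS.
    by under eq_integral do rewrite gee0_abs ?poweR_ge0//.
  have [Z [mZ Z0 subZ]] :=
    @integrable_ae _ (measurableTypeR R) R mu I01 mI (fun t => F t `^ p) iF.
  exists Z; split => // t /= nH; apply: subZ => /= fin; apply: nH => It.
  have := fin It; rewrite /g indicE mem_set// mul1r.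
  have := F0 t; case: (F t) => [r r0 _| |//].
    by rewrite poweR_EFin/= -powRrM mulfV ?gt_eqF// powRr1.
  by rewrite poweRyr// gt_eqF.
- apply: lebesgue_differentiation; apply: open_integrable_locally; first exact: openT.
  apply/integrableP; split; first exact/measurable_EFinP.
  apply: le_lt_trans Ffin.
  rewrite [leRHS]integral_indicE; apply: ge0_le_integral => //.
  - by apply: measurableT_comp => //; exact/measurable_EFinP.
  - apply: emeasurable_funM => //; apply/measurable_EFinP; exact: measurable_indic.
  move=> t _; rewrite /= ger0_norm// /g EFinM; apply: lee_wpmul2l.
    by rewrite lee_fin indicE ler0n.
  by case: (F t `^ p) (poweR_ge0 (F t) p) => [r|_|//] //=; rewrite leey.
Qed.

Lemma riesz_admissible_dobinski (p : R) (f : R * R -> \bar R) : (1 < p <= 2)%R ->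
  riesz_admissible p^-1 (dobinski_circle R) f ->
  \int[circle_measure R]_(y in circle R) (f y `^ p) < +oo ->
  riesz_admissible p^-1 (circle R) f.
Proof.
move=> p12 [mf f0 fD] ffin; split => // z /circle_expi[x0 x001 <-].
pose F t := f (expi t).
have mF : measurable_fun setT F by exact: measurable_comp_expi.
have F0 t : 0 <= F t by apply: f0; exact: expi_circle.
pose b := (1 - p^-1)%R.
have fu x : riesz_potential p^-1 f (expi x) = circle_potential b F x by exact: riesz_potentialE.
have uD x : dobinski R x -> 1 <= circle_potential b F x.
  by move=> Dx; rewrite -fu; apply: fD; exists x.
rewrite fu leNgt; apply/negP => ux0.
have Ffin : \int[mu]_(t in I01) (F t `^ p) < +oo.
  move: ffin; rewrite ge0_integral_circle//.
  - exact: (measurableT_comp (measurable_poweR p) mf).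
  - by move=> y _; exact: poweR_ge0.
have p1 : (1 < p)%R by case/andP: p12.
have [g [mg g0 Fg gL]] := root_density p1 mF F0 Ffin.
have x0in : (0 < x0 < 1)%R.
  rewrite !lt_neqAle; case/andP: x001 => -> ->; rewrite !andbT.
  by apply/andP; split; apply/eqP => e; move: ux0; apply/negP; rewrite -leNgt; apply: uD; apply: dobinski01; [left|right].
have u0 : 0 <= circle_potential b F x0 by exact: circle_potential_ge0.
have ufin : circle_potential b F x0 \is a fin_num by rewrite ge0_fin_numE// (lt_trans ux0)// ltry.
move: u0 ux0; rewrite -(fineK ufin) lee_fin lte_fin; set U0 := fine _ => U00 U01.
(* Room above [U0] starts the iteration; room below 1 absorbs the factor [1 / (1 - 8 / L)] at the
   end. *)
pose t := ((U0 + 1) / 2)%R.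
have ut : circle_potential b F x0 < t%:E.
  by rewrite -(fineK ufin) lte_fin -/U0 /t; lra.
have t0 : (0 <= t)%R by rewrite /t; lra.
have [r [r0 xr Hr]] := potential_avg_init (half_exponent p12) mF F0 x0in ut.
have lar : low_average p F t x0 r by split => //; case/andP: x001.
have [x Dx xlim] := low_average_dobinski p12 mF F0 mg g0 Fg gL t0 lar.
have [L L8 Lt] : exists2 L : R, (8 < L)%R & (t / (1 - 8 / L) < 1)%R.
  by apply: far_constant; rewrite t0 /t; lra.
have x01 : (0 <= x <= 1)%R by case: Dx.
have := potential_limit p12 mF F0 x01 L8 t0 xlim.
move/(le_trans (uD _ Dx)); rewrite lee_fin; lra.
Qed.

End full_capacity.

Local Open Scope ring_scope.

Theorem theorem1p1 (R : realType) (p : R) (hp : 1 < p) :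
  (p <= 2 ->
     riesz_capacity p^-1 p (dobinski_circle R) =
     riesz_capacity p^-1 p (circle R)) /\
  (2 < p -> riesz_capacity p^-1 p (dobinski_circle R) = 0%E).
Proof.
split=> [p2|]; last exact: riesz_capacity_dobinski_circle0.
apply/eqP; rewrite eq_le; apply/andP; split.
  apply: le_ereal_inf => _ [f [mf f0 fT] <-]; exists f => //; split => // _ [x _ <-].
  by apply: fT; exact: expi_circle.
apply: le_ereal_inf_tmp => _ [f adm <-].
(* A candidate of infinite energy satisfies the bound trivially; Lebesgue points are available only
   for finite energy. *)
have [fin|] := ltP (\int[circle_measure R]_(y in circle R) (f y `^ p))%E +oo%E; last first.
  by rewrite leye_eq => /eqP ->; exact: leey.
apply: ereal_inf_lbound; exists f => //.
by apply: riesz_admissible_dobinski adm fin; rewrite hp.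
Qed.
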